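(* For any plane tree $S$ (with at least two vertices) there exists a random compact metric space $\mathcal L^{(S)}$ such that the following convergence holds almost surely for the Gromov--Hausdorff topology: $$ n^{-1/2}\cdot\mathsf{Loop}(T_n^{(S)})\ \xrightarrow[n\to\infty]{a.s.}\ 2\sqrt2\cdot\mathcal L^{(S)},$$ where $(T_n^{(S)})_{n\ge|S|}$ is the plane linear preferential attachment model started from $S$.
   Context: A corner of a plane tree is an angular sector formed by two consecutive half-edges around a vertex. For a plane tree $S$ with $|S|=n_0$ vertices, $(T_n^{(S)})_{n\ge n_0}$ is the random sequence of plane trees with $T_{n_0}^{(S)}=S$ such that, for $n\ge n_0$, conditionally on $T_{n_0}^{(S)},\dots,T_n^{(S)}$, the tree $T_{n+1}^{(S)}$ is obtained by grafting an edge leading to a new vertex inside a uniformly chosen corner of $T_n^{(S)}$. The looptree $\mathsf{Loop}(\tau)$ of a plane tree $\tau$ is the graph (multi-edges and self-loops allowed) obtained by replacing each vertex $u$ by a cycle of length $\deg(u)$ and gluing these cycles along the tree structure: its vertices are (the midpoints of) the edges of $\tau$, and for each corner of $\tau$ there is an edge joining the two (possibly equal) edges of $\tau$ bounding that corner. $\mathsf{Loop}(\tau)$ is viewed as a compact metric space by endowing its vertex set with the graph distance. For a metric space $\mathcal M$ and $c>0$, $c\cdot\mathcal M$ is $\mathcal M$ with all distances multiplied by $c$. *)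

(* Defs.v *)
From HB Require Import structures.
From mathcomp Require Import all_boot all_order all_algebra all_fingroup.
From mathcomp Require Import all_classical all_reals all_analysis.

Set Implicit Arguments.
Unset Strict Implicit.
Unset Printing Implicit Defensive.

Import Order.TTheory GRing.Theory Num.Theory.
Import numFieldNormedType.Exports.

Local Open Scope ring_scope.

(* Plane trees are encoded by rotation systems.  The half-edges of a tree with
   edges 0, ..., k-1 are the pairs (e, b), where b tells the two halves of e
   apart; the permutation sends a half-edge to the next one around its vertex.
   Hence vertices are the cycles of the permutation, and a corner is identified
   with the first of the two consecutive half-edges h, s h bounding it.  No
   planarity condition is needed, every rotation system of a tree being planar. *)
Definition half_edge (k : nat) : finType := ('I_k * bool)%type.

Definition flip k (h : half_edge k) : half_edge k := (h.1, ~~ h.2).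

Definition dart_step k (s : {perm half_edge k}) : rel (half_edge k) :=
  fun h h' => (h' == s h) || (h' == flip h).

(* A connected graph is a tree iff it has one more vertex than edges.  As the
   tree reduced to one vertex has no half-edge, it is not a plane_tree. *)
Record plane_tree := PlaneTree {
  nedges : nat;
  next_half : {perm half_edge nedges};
  plane_tree_connected : forall h h', connect (dart_step next_half) h h';
  plane_tree_acyclic : #|porbits next_half| = nedges.+1 }.

Definition tree_order (t : plane_tree) : nat := #|porbits (next_half t)|.

Definition corner (t : plane_tree) : finType := half_edge (nedges t).

Section Graft.
Variable k : nat.
Implicit Types (s : {perm half_edge k}) (c h : half_edge k).

Definition old_half h : half_edge k.+1 := (lift ord_max h.1, h.2).
Definition new_half (b : bool) : half_edge k.+1 := (ord_max, b).

(* The new edge has number k; its half new_half false is inserted between c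
   and s c, and its half new_half true is alone around the new vertex. *)
Definition graft_fun s c (h : half_edge k.+1) : half_edge k.+1 :=
  match unlift ord_max h.1 with
  | Some e => if (e, h.2) == c then new_half false else old_half (s (e, h.2))
  | None => if h.2 then new_half true else old_half (s c)
  end.

Definition extend_fun s (h : half_edge k.+1) : half_edge k.+1 :=
  if unlift ord_max h.1 is Some e then old_half (s (e, h.2)) else h.

Lemma old_half_inj : injective old_half.
Proof.
move=> [e b] [e' b'] /eqP; rewrite xpair_eqE (inj_eq lift_inj) => /andP[].
by move=> /eqP /= -> /eqP ->.
Qed.

Lemma new_old b h : (new_half b == old_half h) = false.
Proof.
by rewrite /new_half /old_half xpair_eqE (negPf (neq_lift _ _)).
Qed.

Lemma half_edgeP (h : half_edge k.+1) :
  (exists h', h = old_half h') \/ (exists b, h = new_half b).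
Proof.
case: h => e b; case: (unliftP ord_max e) => [e'|] ->.
  by left; exists (e', b).
by right; exists b.
Qed.

Lemma extend_old s h : extend_fun s (old_half h) = old_half (s h).
Proof. by rewrite /extend_fun /= liftK -surjective_pairing. Qed.

Lemma extend_new s b : extend_fun s (new_half b) = new_half b.
Proof. by rewrite /extend_fun /= unlift_none. Qed.

Lemma extend_inj s : injective (extend_fun s).
Proof.
move=> x y; case: (half_edgeP x) => [[x' ->]|[b ->]];
  case: (half_edgeP y) => [[y' ->]|[b' ->]]; rewrite ?extend_old ?extend_new //.
- by move/old_half_inj/perm_inj ->.
- by move/esym/eqP; rewrite new_old.
- by move/eqP; rewrite new_old.
Qed.

Definition extend s : {perm half_edge k.+1} := perm (@extend_inj s).

Lemma graft_old s c h : graft_fun s c (old_half h) =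
  if h == c then new_half false else old_half (s h).
Proof. by rewrite /graft_fun /= liftK -surjective_pairing. Qed.

Lemma graft_new s c b : graft_fun s c (new_half b) =
  if b then new_half true else old_half (s c).
Proof. by rewrite /graft_fun /= unlift_none. Qed.

Lemma graft_funE s c :
  graft_fun s c =1 (tperm (old_half c) (new_half false) * extend s)%g.
Proof.
move=> x; rewrite permM permE; case: (half_edgeP x) => [[h ->]|[b ->]].
  rewrite graft_old; case: eqP => [->|hc]; first by rewrite tpermL extend_new.
  rewrite tpermD ?extend_old ?new_old //.
  by apply/eqP => /old_half_inj /esym.
rewrite graft_new; case: b; last by rewrite tpermR extend_old.
rewrite tpermD ?extend_new //; first by rewrite eq_sym new_old.
by rewrite /new_half xpair_eqE andbF.
Qed.

Lemma graft_inj s c : injective (graft_fun s c).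
Proof. by move=> x y; rewrite !graft_funE => /perm_inj. Qed.

Definition graft_perm s c : {perm half_edge k.+1} := perm (@graft_inj s c).

Lemma extend_iter s i h : (extend s ^+ i)%g (old_half h) = old_half ((s ^+ i)%g h).
Proof.
by rewrite !permX; elim: i => //= i ->; rewrite permE extend_old.
Qed.

Lemma porbit_extend_old s h :
  porbit (extend s) (old_half h) = old_half @: porbit s h.
Proof.
apply/setP => x; apply/porbitP/imsetP => [[i ->]|[y /porbitP[i ->] ->]].
  by exists ((s ^+ i)%g h); [exact: mem_porbit|exact: extend_iter].
by exists i; rewrite extend_iter.
Qed.

Lemma porbit_extend_new s b : porbit (extend s) (new_half b) = [set new_half b].
Proof.
apply/setP => x; rewrite inE; apply/porbitP/eqP => [[i ->]|->].
  by rewrite permX; elim: i => //= i ->; rewrite permE extend_new.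
by exists 0; rewrite expg0 perm1.
Qed.

Lemma card_porbits_extend s : #|porbits (extend s)| = #|porbits s|.+2.
Proof.
have -> : porbits (extend s) =
    [set new_half false] |: ([set new_half true] |:
      [set old_half @: (B : {set _}) | B in porbits s]).
  apply/setP => B; apply/imsetP/idP => [[x _ ->]|].
    case: (half_edgeP x) => [[h ->]|[b ->]].
      by rewrite porbit_extend_old !inE !imset_f ?orbT.
    by rewrite porbit_extend_new !inE; case: b; rewrite eqxx ?orbT.
  rewrite !inE => /or3P[/eqP->|/eqP->|/imsetP[_ /imsetP[h _ ->] ->]].
  - by exists (new_half false); rewrite ?porbit_extend_new.
  - by exists (new_half true); rewrite ?porbit_extend_new.
  - by exists (old_half h); rewrite ?porbit_extend_old.
have newN b : ([set new_half b] \in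
    [set old_half @: (B : {set _}) | B in porbits s]) = false.
  apply/negP => /imsetP[B _ /setP/(_ (new_half b))].
  rewrite inE eqxx => /esym/imsetP[h _ /eqP].
  by rewrite new_old.
rewrite !cardsU1 !inE !newN orbF (inj_eq set1_inj) /= card_imset.
  by rewrite /new_half xpair_eqE andbF.
exact: imset_inj old_half_inj.
Qed.

Lemma card_porbits_graft s c : #|porbits (graft_perm s c)| = #|porbits s|.+1.
Proof.
have -> : graft_perm s c = (tperm (old_half c) (new_half false) * extend s)%g.
  by apply/permP => x; rewrite permE graft_funE.
have := porbits_mul_tperm (extend s) (old_half c) (new_half false).
rewrite /= porbit_extend_new inE eq_sym new_old /= card_porbits_extend.
by rewrite addn2 addn1 => -[].
Qed.

Lemma graft_connected s c : (forall h h', connect (dart_step s) h h') ->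
  forall x y, connect (dart_step (graft_perm s c)) x y.
Proof.
move=> conn; set r := dart_step _.
have stepn x : r x (graft_perm s c x) by rewrite /r /dart_step eqxx.
have stepf x : r x (flip x) by rewrite /r /dart_step eqxx orbT.
have c_new : connect r (old_half c) (new_half false).
  by have := stepn (old_half c); rewrite permE graft_old eqxx; exact: connect1.
have new_sc : connect r (new_half false) (old_half (s c)).
  by have := stepn (new_half false); rewrite permE graft_new; exact: connect1.
have old h h' : connect r (old_half h) (old_half h').
  have /connectP[p] := conn h h'.
  elim: p h => [h _ ->|y p IH h /= /andP[hy yp] h'E] //.
  apply: connect_trans (IH y yp h'E).
  case/orP: hy => /eqP -> /=; last exact: connect1 (stepf (old_half h)).
  have [->|hc] := eqVneq h c; first exact: connect_trans c_new new_sc.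
  apply: connect1; have := stepn (old_half h).
  by rewrite permE graft_old (negPf hc).
have to x : connect r x (old_half c).
  case: (half_edgeP x) => [[h ->] //|[[] ->]]; last first.
    exact: connect_trans new_sc (old _ _).
  apply: connect_trans (connect1 (stepf _)) _.
  exact: connect_trans new_sc (old _ _).
have from x : connect r (old_half c) x.
  case: (half_edgeP x) => [[h ->] //|[[] ->]] //.
  exact: connect_trans c_new (connect1 (stepf (new_half false))).
by move=> x y; exact: connect_trans (to x) (from y).
Qed.

End Graft.

Lemma graft_acyclic (t : plane_tree) (c : corner t) :
  #|porbits (graft_perm (next_half t) c)| = (nedges t).+2.
Proof. by rewrite card_porbits_graft plane_tree_acyclic. Qed.

Definition graft (t : plane_tree) (c : corner t) : plane_tree :=
  PlaneTree (graft_connected c (@plane_tree_connected t)) (graft_acyclic c).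

(* Length of a shortest path of the graph with adjacency relation e. *)
Definition graph_dist (V : finType) (e : rel V) (x y : V) : nat :=
  seq.find (fun d => [exists p : d.-tuple V, path e x p && (last x p == y)])
    (iota 0 #|V|).

Section GraphDist.
Variables (V : finType) (e : rel V).
Hypothesis e_sym : symmetric e.
Hypothesis e_conn : forall x y, connect e x y.

Let joined x y d := [exists p : d.-tuple V, path e x p && (last x p == y)].

Lemma graph_distP x y : exists p : seq V,
  [/\ path e x p, last x p = y & size p = graph_dist e x y].
Proof.
have hasd : has (joined x y) (iota 0 #|V|).
  have /connectP[p0 p0P ->] := e_conn x y.
  case/shortenP: p0P => p pP pU _; apply/hasP; exists (size p).
    rewrite mem_iota /= add0n; have := max_card [in x :: p].
    by rewrite (card_uniqP pU).
  by apply/existsP; exists (in_tuple p); rewrite pP eqxx.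
have := nth_find 0 hasd; rewrite -/(graph_dist e x y).
rewrite nth_iota ?add0n; last by rewrite -[X in (_ < X)%N](size_iota 0) -has_find.
by rewrite /joined => /existsP[p /andP[? /eqP ?]]; exists p; rewrite size_tuple.
Qed.

Lemma graph_dist_le x p : path e x p -> (graph_dist e x (last x p) <= size p)%N.
Proof.
move=> pP; rewrite leqNgt; apply/negP => lt.
have ltV : (size p < #|V|)%N.
  by apply: leq_trans lt _; rewrite -[X in (_ <= X)%N](size_iota 0) find_size.
have : joined x (last x p) (size p).
  by apply/existsP; exists (in_tuple p); rewrite pP eqxx.
by have := before_find 0 lt; rewrite nth_iota ?add0n // /joined => ->.
Qed.

Lemma graph_distxx x : graph_dist e x x = 0.
Proof. by apply/eqP; rewrite -leqn0; exact: (@graph_dist_le x [::]). Qed.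

Lemma graph_dist_eq0 x y : graph_dist e x y = 0 -> x = y.
Proof.
by have [p [_ <- <-]] := graph_distP x y; move/size0nil ->.
Qed.

Lemma graph_dist_sym_le x y : (graph_dist e x y <= graph_dist e y x)%N.
Proof.
have [p [pP <- <-]] := graph_distP y x.
have := @graph_dist_le (last y p) (rev (belast y p)).
have -> : last (last y p) (rev (belast y p)) = y.
  by case: p {pP} => //= z p; rewrite rev_cons last_rcons.
by rewrite size_rev size_belast rev_path; apply; under eq_path do rewrite e_sym.
Qed.

Lemma graph_dist_sym x y : graph_dist e x y = graph_dist e y x.
Proof. by apply/eqP; rewrite eqn_leq !graph_dist_sym_le. Qed.

Lemma graph_dist_triangle y x z :
  (graph_dist e x z <= graph_dist e x y + graph_dist e y z)%N.
Proof.
have [p [pP py <-]] := graph_distP x y; have [q [qP qz <-]] := graph_distP y z.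
rewrite -size_cat -qz -py -last_cat; apply: graph_dist_le.
by rewrite cat_path pP py.
Qed.

End GraphDist.

(* Corner c contributes the edge joining c.1 and (next_half t c).1; multiplicities
   and self-loops are irrelevant to the graph distance. *)
Definition loop_adj (t : plane_tree) : rel 'I_(nedges t) := fun e f =>
  [exists c : corner t, ((c.1 == e) && ((next_half t c).1 == f))
                     || ((c.1 == f) && ((next_half t c).1 == e))].

Lemma loop_adj_sym t : symmetric (@loop_adj t).
Proof.
by move=> e f; apply/existsP/existsP => -[c]; rewrite orbC => ?; exists c.
Qed.

Lemma loop_adj_connected t e f : connect (@loop_adj t) e f.
Proof.
suff H (h h' : corner t) : connect (@loop_adj t) h.1 h'.1.
  exact: (H (e, true) (f, true)).
have /connectP[p] := plane_tree_connected h h'.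
elim: p h => [h _ ->|y p IH h /= /andP[hy yp] h'E] //.
apply: connect_trans (IH y yp h'E); case/orP: hy => /eqP -> //.
by apply: connect1; apply/existsP; exists h; rewrite !eqxx.
Qed.

Lemma nedges_gt0 t : (0 < nedges t)%N.
Proof.
have : (#|porbits (next_half t)| <= #|corner t|)%N by exact: leq_imset_card.
by rewrite plane_tree_acyclic card_prod card_ord; case: (nedges t).
Qed.

Local Open Scope classical_set_scope.

Record compact_metric_space (R : realType) := CompactMetricSpace {
  cms_space :> metricType R;
  cms_nonempty : [set: cms_space] !=set0;
  cms_compact : compact [set: cms_space] }.

Section Looptree.
Variables (R : realType) (t : plane_tree).

Definition looptree_space (R0 : realType) (t0 : plane_tree) : Type :=
  'I_(nedges t0).

HB.instance Definition _ := Finite.on (looptree_space R t).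

Definition looptree_dist (e f : looptree_space R t) : R :=
  (graph_dist (@loop_adj t) e f)%:R.

Let distxx e : looptree_dist e e = 0.
Proof. by rewrite /looptree_dist graph_distxx. Qed.

Let dist_eq0 e f : looptree_dist e f = 0 -> e = f.
Proof.
by move/eqP; rewrite pnatr_eq0 => /eqP /(graph_dist_eq0 (@loop_adj_connected t)).
Qed.

Let distC e f : looptree_dist e f = looptree_dist f e.
Proof.
congr _%:R; apply: graph_dist_sym.
  exact: loop_adj_sym.
exact: loop_adj_connected.
Qed.

Let dist_triangle f e g :
  looptree_dist e g <= looptree_dist e f + looptree_dist f g.
Proof.
rewrite -natrD ler_nat; apply: graph_dist_triangle; exact: loop_adj_connected.
Qed.

HB.instance Definition _ := isMetric.Build R (looptree_space R t)
  distxx dist_eq0 distC dist_triangle.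

Lemma looptree_nonempty : [set: looptree_space R t] !=set0.
Proof. by exists (Ordinal (nedges_gt0 t)). Qed.

Lemma looptree_compact : compact [set: looptree_space R t].
Proof. by apply: finite_compact; exact: finite_finset. Qed.

Definition Loop : compact_metric_space R :=
  CompactMetricSpace looptree_nonempty looptree_compact.

End Looptree.

(* The space M with distances multiplied by c > 0 (the factor is replaced by 1
   when c <= 0, so that rescale is total). *)
Definition scale_factor (R : realType) (c : R) : R := if 0 < c then c else 1.

Definition scaled_space (R : realType) (c : R) (M : metricType R) : Type := M.

Section Scale.
Variables (R : realType) (c : R).

Let factor_gt0 : 0 < scale_factor c.
Proof. by rewrite /scale_factor; case: ifP. Qed.

Section Metric.
Variable M : metricType R.

HB.instance Definition _ := Choice.on (scaled_space c M).

Definition scaled_dist (x y : scaled_space c M) : R :=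
  scale_factor c * mdist (x : M) (y : M).

Let distxx x : scaled_dist x x = 0.
Proof. by rewrite /scaled_dist mdistxx mulr0. Qed.

Let dist_eq0 x y : scaled_dist x y = 0 -> x = y.
Proof.
by move/eqP; rewrite mulf_eq0 gt_eqF //= => /eqP /mdist_positivity.
Qed.

Let distC x y : scaled_dist x y = scaled_dist y x.
Proof. by rewrite /scaled_dist metric_sym. Qed.

Let dist_triangle y x z :
  scaled_dist x z <= scaled_dist x y + scaled_dist y z.
Proof. by rewrite -mulrDr ler_pM2l // metric_triangle. Qed.

HB.instance Definition _ := isMetric.Build R (scaled_space c M)
  distxx dist_eq0 distC dist_triangle.

Lemma scaled_id_continuous : continuous (id : M -> scaled_space c M).
Proof.
move=> x; apply/metricType_numDomainType.cvgrPdist_lt => e e0.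
have := @metricType_numDomainType.cvgr_dist_lt _ _ _ (nbhs x) _ id x cvg_id.
move=> /(_ _ _ (divr_gt0 e0 factor_gt0)); apply: filterS => y.
by rewrite ltr_pdivlMr // mulrC.
Qed.

End Metric.

Lemma scaled_nonempty (M : compact_metric_space R) :
  [set: scaled_space c M] !=set0.
Proof. exact: (@cms_nonempty R M). Qed.

Lemma scaled_compact (M : compact_metric_space R) :
  compact [set: scaled_space c M].
Proof.
rewrite -(image_id [set: scaled_space c M]).
apply: (@continuous_compact M (scaled_space c M : topologicalType) id [set: M]).
  by apply: continuous_subspaceT; exact: (@scaled_id_continuous M).
exact: cms_compact.
Qed.

Definition rescale (M : compact_metric_space R) : compact_metric_space R :=
  CompactMetricSpace (scaled_nonempty M) (@scaled_compact M).

End Scale.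

Section GromovHausdorff.
Variable R : realType.

Definition isometric_embedding (X Z : metricType R) (f : X -> Z) :=
  forall x y, mdist (f x) (f y) = mdist x y.

Definition hausdorff_dist (Z : metricType R) (A B : set Z) : R :=
  inf [set r | [/\ 0 < r, A `<=` \bigcup_(b in B) ball b r
                        & B `<=` \bigcup_(a in A) ball a r]].

Definition gh_dist (X Y : compact_metric_space R) : R :=
  inf [set r | exists (Z : metricType R) (f : X -> Z) (g : Y -> Z),
    [/\ isometric_embedding f, isometric_embedding g
      & r = hausdorff_dist (range f) (range g)]].

Definition gh_open (U : compact_metric_space R -> Prop) : Prop :=
  forall X, U X -> exists2 e, 0 < e & forall Y, gh_dist X Y < e -> U Y.

(* The Borel sigma-algebra of the Gromov-Hausdorff topology, i.e. the smallest
   one containing the open sets.  Universe levels prevent compact_metric_space R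
   from being an argument of set, hence of <<s _ >>. *)
Inductive gh_borel : (compact_metric_space R -> Prop) -> Prop :=
  | gh_borel_open U : gh_open U -> gh_borel U
  | gh_borelC B : gh_borel B -> gh_borel (fun X => ~ B X)
  | gh_borel_bigcup (B : nat -> compact_metric_space R -> Prop) :
      (forall n, gh_borel (B n)) -> gh_borel (fun X => exists n, B n X).

End GromovHausdorff.

Definition random_compact_metric_space (R : realType) (d : measure_display)
    (Omega : measurableType d) (L : Omega -> compact_metric_space R) : Prop :=
  forall B, gh_borel B -> measurable [set w | B (L w)].

Section PreferentialAttachment.
Variables (R : realType) (d : measure_display) (Omega : measurableType d).
Variables (P : probability Omega R) (S : plane_tree).
Variable T : nat -> Omega -> plane_tree.

Definition past (t : nat -> plane_tree) (n : nat) : set Omega :=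
  [set w | forall m, (tree_order S <= m <= n)%N -> T m w = t m].

(* T n is only meaningful for n >= |S|.  The conditional law of T n.+1 given
   T |S| = t |S|, ..., T n = t n is that of the graft of a new edge in a uniform
   corner of t n; the conditioning is multiplied out, so that nothing is
   required of null events. *)
Definition preferential_attachment : Prop :=
  [/\ forall n t, (tree_order S <= n)%N -> measurable [set w | T n w = t],
      P [set w | T (tree_order S) w = S] = 1%E
    & forall n (t : nat -> plane_tree) (t' : plane_tree), (tree_order S <= n)%N ->
        P (past t n `&` [set w | T n.+1 w = t']) =
        (P (past t n) *
         (#|[set c : corner (t n) | `[< graft c = t' >] ]%SET|%:R
            / #|corner (t n)|%:R)%:E)%E].

End PreferentialAttachment.

(* Main.v *)
Require Import Defs.
From HB Require Import structures.
From mathcomp Require Import all_boot all_order all_algebra all_fingroup.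
From mathcomp Require Import all_classical all_reals all_analysis.
From mathcomp Require Import measurable_realfun ring lra.

(* Grafting an edge in a corner subdivides the corresponding edge of the looptree
   and hangs a self-loop at the new vertex.  A given distance d in the looptree
   therefore increases by at most one, with probability at most d / 2k when the
   tree has k edges: divided by sqrt (k - 1/2) it is a nonnegative supermartingale,
   the upward moves of which are controlled by a second moment.  An exponential
   moment shows that the distances from all the edges present at time n to those
   present at time m are at most of order (n / m)^(1/2) log n.  Applying both
   estimates along polynomially growing times, with summable expected errors,
   the rescaled distances converge almost surely to a totally bounded pseudometric
   on nat; its completion is the limit, all intermediate times being reached by
   monotonicity of the distances.  The law of the Brownian looptree plays no role,
   the factor 2 sqrt 2 being absorbed in the limit. *)

Set Implicit Arguments.
Unset Strict Implicit.
Unset Printing Implicit Defensive.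

Import Order.TTheory GRing.Theory Num.Theory.
Import numFieldNormedType.Exports.

Local Open Scope ring_scope.
Local Open Scope classical_set_scope.

(** * Distances in a looptree after grafting *)

(** A graft can break one geodesic while another survives, so a distance is not an exact urn count
    and only upper bounds on its growth are available. They suffice: if each rescaled distance rises
    by at most a summable error from one level to the next, then the partial sums of the errors
    minus that distance are eventually nondecreasing and bounded, and convergence is deterministic.
    The moment bounds do not handle all pairs of edges at once: the errors are summed over the pairs
    of a small core, and any other edge is replaced by a nearby core edge. Edges are named by
    natural numbers that grafting preserves, so that the distances of all times live on the one set
    [nat], where the limit is built. The limit is selected path by path; its measurability is
    recovered afterwards, because membership of the limit in an open set can be read off the trees
    through countable operations. Gromov-Hausdorff estimates all go through correspondences, with
    constants that are not sharp. *)

Definition loop_dist (t : plane_tree) (e f : nat) : nat :=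
  match insub e, insub f with
  | Some x, Some y => graph_dist (@loop_adj t) x y
  | _, _ => 0%N
  end.

Section LoopDist.
Variable t : plane_tree.
Implicit Types e f g : nat.

Lemma loop_distE (x y : 'I_(nedges t)) : loop_dist t x y = graph_dist (@loop_adj t) x y.
Proof. by rewrite /loop_dist !valK. Qed.

Lemma loop_distxx e : loop_dist t e e = 0%N.
Proof. by rewrite /loop_dist; case: insubP => // x _ _; rewrite graph_distxx. Qed.

Lemma loop_dist_sym e f : loop_dist t e f = loop_dist t f e.
Proof.
rewrite /loop_dist; case: insubP => [x _ _|_]; case: insubP => // y _ _.
by apply: graph_dist_sym; [exact: loop_adj_sym|exact: loop_adj_connected].
Qed.

Lemma loop_dist_triangle f e g : (f < nedges t)%N ->
  (loop_dist t e g <= loop_dist t e f + loop_dist t f g)%N.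
Proof.
move=> ft; rewrite /loop_dist (insubT (fun i => i < nedges t)%N ft).
case: insubP => [x _ _|//]; case: insubP => // y _ _.
by apply: graph_dist_triangle; exact: loop_adj_connected.
Qed.

Lemma loop_dist_le_nedges e f : (loop_dist t e f <= nedges t)%N.
Proof.
rewrite /loop_dist; case: insubP => [x _ _|//]; case: insubP => // y _ _.
by rewrite -[leqRHS]card_ord -[leqRHS](size_iota 0) find_size.
Qed.

End LoopDist.

Lemma loop_adj_next (u : plane_tree) (h : corner u) : loop_adj h.1 (next_half u h).1.
Proof. by apply/existsP; exists h; rewrite !eqxx. Qed.

Section GraftDist.
Variables (t : plane_tree) (c : corner t).
Let k := nedges t.
Let t' := graft c.
Let old (x : 'I_k) : 'I_(nedges t') := lift ord_max x.
Let new : 'I_(nedges t') := ord_max.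

Lemma graft_adj_old (h : corner t) : h != c -> loop_adj (old h.1) (old (next_half t h).1).
Proof.
move=> hc; have := @loop_adj_next t' (old_half h).
by rewrite /= permE graft_old (negPf hc).
Qed.

Lemma graft_adj_corner : loop_adj (old c.1) new.
Proof. by have := @loop_adj_next t' (old_half c); rewrite /= permE graft_old eqxx. Qed.

Lemma graft_adj_next : loop_adj new (old (next_half t c).1).
Proof.
by have := @loop_adj_next t' (new_half _ false); rewrite /= permE graft_new.
Qed.

(** A retraction of the new looptree onto the old one: sending the new vertex to one end of the
    subdivided edge maps adjacent vertices to adjacent or equal ones, so a graft never shortens a
    distance between old edges. *)
Let proj (y : 'I_(nedges t')) : 'I_k := odflt c.1 (unlift ord_max y).

Let proj_old x : proj (old x) = x.
Proof. by rewrite /proj liftK. Qed.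

Let proj_new : proj new = c.1.
Proof. by rewrite /proj unlift_none. Qed.

Let proj_adj y z : loop_adj y z -> proj y = proj z \/ loop_adj (proj y) (proj z).
Proof.
have H (h : corner t') : proj h.1 = proj (next_half t' h).1 \/
    loop_adj (proj h.1) (proj (next_half t' h).1).
  rewrite /= permE; case: (half_edgeP h) => [[h' ->]|[b ->]].
    rewrite graft_old; case: eqP => [->|hc].
      by left; exact: etrans (proj_old c.1) (esym proj_new).
    by right; rewrite /= !proj_old; exact: loop_adj_next.
  rewrite graft_new; case: b; first by left.
  by right; rewrite /= proj_old proj_new; exact: loop_adj_next.
case/existsP => h /orP[]/andP[/eqP <- /eqP <-]; have [E|A] := H h.
- by left.
- by right.
- by left.
- by right; rewrite loop_adj_sym.
Qed.

Lemma project_path y q : path (@loop_adj t') y q ->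
  exists p, [/\ path (@loop_adj t) (proj y) p, last (proj y) p = proj (last y q)
    & (size p <= size q)%N].
Proof.
elim: q y => [y _|z q IH y /= /andP[yz /IH[p [pP pl ps]]]]; first by exists [::].
have [->|A] := proj_adj yz; first by exists p; split => //; exact: leqW.
by exists (proj z :: p); rewrite /= A.
Qed.

Lemma loop_dist_graft_ge e f : (e < k)%N -> (f < k)%N ->
  (loop_dist t e f <= loop_dist t' e f)%N.
Proof.
move=> ek fk; pose x := Ordinal ek; pose y := Ordinal fk.
have -> : loop_dist t e f = graph_dist (@loop_adj t) x y by exact: (loop_distE x y).
have -> : loop_dist t' e f = graph_dist (@loop_adj t') (old x) (old y).
  by have := loop_distE (old x) (old y); rewrite !lift_max.
have [q [qP ql <-]] := graph_distP (@loop_adj_connected t') (old x) (old y).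
have [p [pP pl ps]] := project_path qP.
move: pP pl; rewrite proj_old ql proj_old => pP pl.
by apply: leq_trans ps; rewrite -pl; exact: graph_dist_le.
Qed.

Lemma loop_dist_new : (loop_dist t' k c.1 <= 1)%N.
Proof.
have -> : loop_dist t' k c.1 = graph_dist (@loop_adj t') new (old c.1).
  by have := loop_distE new (old c.1); rewrite lift_max.
have := @graph_dist_le _ (@loop_adj t') new [:: old c.1].
by rewrite /= loop_adj_sym graft_adj_corner; exact.
Qed.

End GraftDist.

(* The corners crossed by a simple path are distinct: an endpoint of the first
   one is left forever. *)
Lemma simple_path_corners (t : plane_tree) (x : 'I_(nedges t)) p :
  path (@loop_adj t) x p -> uniq (x :: p) ->
  exists cs : seq (corner t), [/\ uniq cs, size cs = size p,
    {in cs, forall h, h.1 \in x :: p /\ (next_half t h).1 \in x :: p} &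
    forall c : corner t, exists q : seq 'I_(nedges (graft c)),
      [/\ path (@loop_adj (graft c)) (lift ord_max x) q,
          last (lift ord_max x) q = lift ord_max (last x p)
        & size q = (size p + (c \in cs))%N]].
Proof.
elim: p x => [x _ _|y p IH x /= /andP[xy yp] /andP[xnp up]].
  by exists [::]; split => // c; exists [::].
have [cs [ucs scs ends qs]] := IH y yp up.
case/existsP: xy => h hE.
have hx : x = h.1 \/ x = (next_half t h).1.
  by case/orP: hE => /andP[/eqP h1 /eqP h2]; [left|right].
have hy : h.1 \in [:: x; y] /\ (next_half t h).1 \in [:: x; y].
  by case/orP: hE => /andP[/eqP -> /eqP ->]; rewrite !inE !eqxx ?orbT.
have hcs : h \notin cs.
  apply/negP => /ends[h1 h2].
  by case: hx xnp => ->; rewrite ?h1 ?h2.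
have sub z : z \in [:: x; y] -> z \in [:: x, y & p].
  by rewrite !inE => /orP[->//|->]; rewrite orbT.
exists (h :: cs); split; rewrite /= ?hcs ?scs //.
  move=> g; rewrite inE => /orP[/eqP ->|/ends[g1 g2]].
    by case: hy => ? ?; split; exact: sub.
  by split; rewrite inE ?g1 ?g2 orbT.
move=> c; have [q [qP ql sq]] := qs c.
(* If [c] is the first corner crossed, its edge is subdivided and the path detours through the new
   vertex [ord_max]; [hcs] guarantees that this is the only extra step. *)
have [hc|hc] := eqVneq h c.
  exists [:: ord_max, lift ord_max y & q].
  have cE : c \in h :: cs by rewrite hc mem_head.
  rewrite cE /= qP ql sq -hc (negPf hcs) addn0 addn1; split => //.
  rewrite andbT; case/orP: hE => /andP[/eqP <- /eqP <-].
    by rewrite graft_adj_corner graft_adj_next.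
  by rewrite loop_adj_sym graft_adj_next loop_adj_sym graft_adj_corner.
exists (lift ord_max y :: q); rewrite /= qP ql sq inE eq_sym (negPf hc); split => //.
rewrite andbT; case/orP: hE => /andP[/eqP <- /eqP <-]; first exact: graft_adj_old.
by rewrite loop_adj_sym graft_adj_old.
Qed.

(** [A] consists of the corners crossed by one geodesic: a graft elsewhere leaves this path intact,
    a graft in [A] lengthens it by one step. *)
Lemma loop_dist_graft (t : plane_tree) e f : (e < nedges t)%N -> (f < nedges t)%N ->
  exists A : {set corner t}, #|A| = loop_dist t e f /\
    forall c, (loop_dist (graft c) e f <= loop_dist t e f + (c \in A))%N.
Proof.
move=> ek fk; pose x := Ordinal ek; pose y := Ordinal fk.
have E : loop_dist t e f = graph_dist (@loop_adj t) x y by exact: (loop_distE x y).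
have [p [pP pl ps]] := graph_distP (@loop_adj_connected t) x y.
case/shortenP: (pP) pl => p' p'P up' subp pl.
have p's : size p' = loop_dist t e f.
  apply/eqP; rewrite E eqn_leq -{2}pl graph_dist_le// andbT -ps.
  by apply: uniq_leq_size subp; case/andP: up'.
have [cs [ucs scs _ qs]] := simple_path_corners p'P up'.
exists [set h in cs]%SET; split.
  by rewrite -p's -scs cardsE; exact/card_uniqP.
move=> c; rewrite inE -p's; have [q [qP ql <-]] := qs c.
have -> : loop_dist (graft c) e f = graph_dist (@loop_adj (graft c))
    (lift ord_max x) (last (lift ord_max x) q).
  rewrite ql pl.
  by have := @loop_distE (graft c) (lift ord_max x) (lift ord_max y); rewrite !lift_max.
exact: graph_dist_le.
Qed.

(** * Mean effect of one graft *)

Section GraftMean.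
Variable R : realType.
Implicit Types (t : plane_tree) (F G : plane_tree -> R).

(** The transition operator of the model: [integral_graft] identifies it with the conditional mean
    of [F] at the next tree. *)
Definition graft_mean F t : R := (\sum_(c : corner t) F (graft c)) / #|corner t|%:R.

Lemma card_corner t : #|corner t| = (nedges t).*2.
Proof. by rewrite card_prod card_ord card_bool muln2. Qed.

Lemma corner_gt0 t : 0 < #|corner t|%:R :> R.
Proof. by rewrite ltr0n card_corner double_gt0 nedges_gt0. Qed.

(* A count that increases by at most one, for at most as many corners as its
   current value, behaves like the number of balls in a Polya type urn. *)
Lemma graft_mean_urn t (g : plane_tree -> nat) (A : {set corner t}) (phi : nat -> R) :
  {homo phi : a b / (a <= b)%N >-> a <= b} -> #|A| = g t ->
  (forall c : corner t, (g (graft c) <= g t + (c \in A))%N) ->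
  graft_mean (phi \o g) t <=
    phi (g t) + (g t)%:R / (nedges t).*2%:R * (phi (g t).+1 - phi (g t)).
Proof.
move=> phi_mono cardA gA; rewrite /graft_mean ler_pdivrMr ?corner_gt0//.
have -> : (phi (g t) + (g t)%:R / (nedges t).*2%:R * (phi (g t).+1 - phi (g t)))
   * #|corner t|%:R = \sum_(c : corner t)
     (phi (g t) + (if c \in A then phi (g t).+1 - phi (g t) else 0)).
  rewrite big_split /= sumr_const -big_mkcond /= sumr_const cardA.
  have := corner_gt0 t; rewrite -(mulr_natl (phi _)) -(mulr_natl (_ - _)) card_corner.
  by move=> K0; field; rewrite gt_eqF.
apply: ler_sum => c _ /=; case: (boolP (c \in A)) (gA c) => cA h.
  by rewrite addrC subrK -addn1; exact: phi_mono.
by rewrite addr0; apply: phi_mono; rewrite addn0 in h.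
Qed.

End GraftMean.

(** * Distance to the core formed by the first [m] edges *)

Definition dist_to (m : nat) (t : plane_tree) (v : nat) : nat :=
  \big[minn/nedges t]_(u <- iota 0 m) loop_dist t v u.

Section DistTo.
Variable m : nat.
Implicit Types (t : plane_tree) (u v : nat).

Lemma dist_to_le t v u : (u < m)%N -> (dist_to m t v <= loop_dist t v u)%N.
Proof.
have -> : (u < m)%N = (u \in iota 0 m) by rewrite mem_iota.
rewrite /dist_to; elim: (iota 0 m) => // x s IH; rewrite inE big_cons geq_min.
by case/predU1P => [->|/IH ->]; rewrite ?leqnn ?orbT.
Qed.

(** The default value [nedges t] of the minimum dominates every distance, so the minimum is attained
    once the core is nonempty. *)
Lemma dist_to_ex t v : (0 < m)%N ->
  exists2 u, (u < m)%N & dist_to m t v = loop_dist t v u.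
Proof.
move=> m0; suff [u us ->] : exists2 u, u \in iota 0 m &
    dist_to m t v = loop_dist t v u.
  by exists u => //; rewrite mem_iota in us.
rewrite /dist_to; case: m m0 => // n _; elim: n 0%N => [|n IH] i.
  exists i; rewrite ?mem_head//= big_cons big_nil.
  by apply/minn_idPl; exact: loop_dist_le_nedges.
have [u us E] := IH i.+1.
have -> : iota i n.+2 = i :: iota i.+1 n.+1 by [].
rewrite big_cons E.
have [le|lt] := leqP (loop_dist t v i) (loop_dist t v u).
  by exists i; rewrite ?mem_head.
by exists u => //; rewrite inE us orbT.
Qed.

Lemma dist_to_self t v : (v < m)%N -> dist_to m t v = 0%N.
Proof. by move=> vm; apply/eqP; rewrite -leqn0 -(loop_distxx t v) dist_to_le. Qed.

Lemma dist_to_graft t v : (0 < m <= nedges t)%N -> (v < nedges t)%N ->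
  exists A : {set corner t}, #|A| = dist_to m t v /\
    forall c, (dist_to m (graft c) v <= dist_to m t v + (c \in A))%N.
Proof.
move=> /andP[m0 mt] vt; have [u um E] := dist_to_ex t v m0.
have [A [cA hA]] := loop_dist_graft vt (leq_trans um mt).
exists A; split; first by rewrite cA.
by move=> c; rewrite E; apply: leq_trans (hA c); exact: dist_to_le.
Qed.

(** One unit joins the new vertex to [c.1], the other is the possible increase, under the same
    graft, of the distance from [c.1] to the core. *)
Lemma dist_to_new t (c : corner t) : (0 < m <= nedges t)%N ->
  (dist_to m (graft c) (nedges t) <= (dist_to m t c.1).+2)%N.
Proof.
move=> mt; have /andP[m0 _] := mt.
have [A [_ /(_ c) hA]] := dist_to_graft mt (ltn_ord c.1).
have {}hA : (dist_to m (graft c) c.1 <= (dist_to m t c.1).+1)%N.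
  by apply: leq_trans hA _; rewrite -addn1 leq_add2l leq_b1.
have [u um E] := dist_to_ex (graft c) c.1 m0.
apply: leq_trans (dist_to_le _ _ um) _.
have ct : (c.1 < nedges (graft c))%N := leq_trans (ltn_ord c.1) (leqnSn _).
apply: leq_trans (@loop_dist_triangle (graft c) c.1 (nedges t) u ct) _.
by rewrite -E; exact: leq_add (loop_dist_new c) hA.
Qed.

End DistTo.

(** * Supermartingales built from rescaled distances *)

Section Moments.
Variable R : realType.
Implicit Types (t : plane_tree) (k m n : nat) (x : R).

(** The shift by 1/2 pays for a second-order term: (k - 1/2)(1 + 1/(2k))^2 = k + 1/2 - 1/(4k) -
    1/(8k^2) stays below (k + 1) - 1/2, whereas k (1 + 1/(2k))^2 = k + 1 + 1/(4k) exceeds k + 1. *)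
Definition loop_scale k : R := Num.sqrt (k%:R - 2^-1).

Lemma loop_scale_sqr k : (0 < k)%N -> loop_scale k ^+ 2 = k%:R - 2^-1.
Proof.
move=> k0; rewrite sqr_sqrtr// subr_ge0.
have : 1 <= k%:R :> R by rewrite ler1n.
by lra.
Qed.

Lemma loop_scale_gt0 k : (0 < k)%N -> 0 < loop_scale k.
Proof.
move=> k0; rewrite sqrtr_gt0 subr_gt0.
have : 1 <= k%:R :> R by rewrite ler1n.
by lra.
Qed.

Lemma loop_scale_step k : (0 < k)%N ->
  loop_scale k * (1 + (k.*2%:R)^-1) <= loop_scale k.+1.
Proof.
move=> k0; have kR : 1 <= k%:R :> R by rewrite ler1n.
have s0 := loop_scale_gt0 k0; have s0' := loop_scale_gt0 (ltn0Sn k).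
have h : k%:R != 0 :> R by rewrite pnatr_eq0 -lt0n.
rewrite -(@ler_pXn2r _ 2)// ?nnegrE ?ltW// ?mulr_gt0// ?addr_gt0// ?invr_gt0 ?ltr0n ?double_gt0//.
rewrite exprMn !loop_scale_sqr// -muln2 natrM -[k.+1%:R]natr1.
have [u uE] : exists u, u = k%:R^-1 :> R by eexists.
have ku : k%:R * u = 1 by rewrite uE mulfV.
have u0 : 0 < u by rewrite uE invr_gt0; lra.
rewrite invfM -uE; nra.
Qed.

Lemma loop_scale_homo : {in [pred k | (0 < k)%N] &, {homo loop_scale : a b / (a <= b)%N >-> a <= b}}.
Proof.
move=> a b _ _ ab; apply: ler_wsqrtr.
by rewrite lerD2r ler_nat.
Qed.

Definition sqr_excess (x s y : R) : R := Num.max (y / s - x) 0 ^+ 2 + y / s ^+ 2.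

(* With Y the urn value after one step and mu = (d + u) / s' its mean, the bound
   [Num.max (y - x) 0 ^+ 2 <= (Num.max (mu - x) 0 + (y - mu)) ^+ 2] costs the variance
   of Y, which the term [y / s ^+ 2] pays for. *)
Lemma sqr_pos_part_urn (d r s s' x : R) :
  0 <= d -> 0 < r -> d * r <= 1 -> 0 < s -> s * (1 + r) <= s' ->
  sqr_excess x s' d + d * r * (sqr_excess x s' (d + 1) - sqr_excess x s' d)
    <= sqr_excess x s d.
Proof.
move=> d0 r0 dr1 s0 ss'.
have s'0 : 0 < s' by apply: lt_le_trans ss'; rewrite mulr_gt0// addr_gt0.
pose w := s'^-1; pose q := s^-1.
have w0 : 0 < w by rewrite invr_gt0.
have wq : w * (1 + r) <= q.
  by rewrite /w /q ler_pdivrMl// ler_pdivlMr// mulrC.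
pose u := d * r; have u0 : 0 <= u by rewrite mulr_ge0// ltW.
pose p := Num.max ((d + u) * w - x) 0.
have p0 : 0 <= p by rewrite le_max lexx orbT.
have ppE : (d + u) * w - x <= p by rewrite le_max lexx.
have sq y : Num.max (y * w - x) 0 ^+ 2 <= (p + (y - (d + u)) * w) ^+ 2.
  case: (leP (y * w - x) 0) => [_|y0]; first by rewrite expr0n sqr_ge0.
  have le : y * w - x <= p + (y - (d + u)) * w by lra.
  by rewrite ler_pXn2r ?nnegrE ?(ltW y0) ?(le_trans (ltW y0) le).
have pq : p ^+ 2 <= Num.max (d * q - x) 0 ^+ 2.
  rewrite ler_pXn2r ?nnegrE//; last by rewrite le_max lexx orbT.
  rewrite /p ge_max !le_max lexx orbT andbT lerD2r.
  suff -> : (d + u) * w <= d * q by [].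
  have -> : (d + u) * w = d * (w * (1 + r)) by rewrite /u; ring.
  exact: ler_wpM2l.
have qw : w ^+ 2 * (1 + 2 * r) <= q ^+ 2.
  apply: (@le_trans _ _ ((w * (1 + r)) ^+ 2)); first by nra.
  have wr0 : 0 <= w * (1 + r) by rewrite mulr_ge0 ?addr_ge0 ?(ltW w0) ?(ltW r0).
  by rewrite ler_pXn2r ?nnegrE ?(le_trans wr0 wq).
(* The change of scale frees 2 u w^2: one half pays for the mean growth of the linear term, from d
   to d + u, the other for the variance u (1 - u) w^2. *)
have dqw : (d + 2 * u) * w ^+ 2 <= d * q ^+ 2.
  have -> : (d + 2 * u) * w ^+ 2 = d * (w ^+ 2 * (1 + 2 * r)) by rewrite /u; ring.
  exact: ler_wpM2l.
rewrite /sqr_excess -/u -!exprVn -/w -/q.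
have hB := sq d; have hA := sq (d + 1).
set A := Num.max ((d + 1) * w - x) 0 ^+ 2 in hA *.
set B := Num.max (d * w - x) 0 ^+ 2 in hB *.
set C := Num.max (d * q - x) 0 ^+ 2 in pq *.
have hA' : u * A <= u * (p + (d + 1 - (d + u)) * w) ^+ 2 by exact: ler_wpM2l.
have hB' : (1 - u) * B <= (1 - u) * (p + (d - (d + u)) * w) ^+ 2.
  by apply: ler_wpM2l => //; rewrite subr_ge0.
have -> : B + d * w ^+ 2 + u * (A + (d + 1) * w ^+ 2 - (B + d * w ^+ 2)) =
  (1 - u) * B + u * A + (d + u) * w ^+ 2 by ring.
have E : (1 - u) * (p + (d - (d + u)) * w) ^+ 2 +
   u * (p + (d + 1 - (d + u)) * w) ^+ 2 = p ^+ 2 + u * (1 - u) * w ^+ 2 by ring.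
have w20 : 0 <= u ^+ 2 * w ^+ 2 by rewrite mulr_ge0 ?sqr_ge0.
nra.
Qed.

Definition excess (e f : nat) (x : R) k t : R :=
  sqr_excess x (loop_scale k) (loop_dist t e f)%:R.

Lemma excess_ge0 e f x k t : 0 <= excess e f x k t.
Proof. by rewrite addr_ge0 ?sqr_ge0// divr_ge0 ?sqr_ge0. Qed.

Lemma graft_mean_excess e f x t : (e < nedges t)%N -> (f < nedges t)%N ->
  graft_mean (excess e f x (nedges t).+1) t <= excess e f x (nedges t) t.
Proof.
move=> et ft; have [A [cA hA]] := loop_dist_graft et ft.
have k0 := nedges_gt0 t; set k := nedges t in k0 *.
pose phi (d : nat) := sqr_excess x (loop_scale k.+1) d%:R.
have s0 := loop_scale_gt0 (ltn0Sn k).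
have phi_mono : {homo phi : a b / (a <= b)%N >-> a <= b}.
  move=> a b ab; have abR : a%:R <= b%:R :> R by rewrite ler_nat.
  apply: lerD; last by rewrite ler_pM2r// invr_gt0 exprn_gt0.
  have m0 y : 0 <= Num.max y (0 : R) by rewrite le_max lexx orbT.
  rewrite ler_pXn2r ?nnegrE// /phi.
  by rewrite ge_max !le_max lexx orbT andbT lerD2r ler_pM2r ?invr_gt0// abR.
have := @graft_mean_urn R t (fun t => loop_dist t e f) A phi phi_mono cA hA.
move=> /le_trans; apply; rewrite /phi -natr1.
apply: (@sqr_pos_part_urn _ _ (loop_scale k) (loop_scale k.+1) x) => //.
- by rewrite invr_gt0 ltr0n double_gt0.
- rewrite ler_pdivrMr ?ltr0n ?double_gt0// mul1r ler_nat.
  by apply: leq_trans (loop_dist_le_nedges t e f) _; rewrite -addnn leq_addr.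
- exact: loop_scale_gt0.
- exact: loop_scale_step.
Qed.

(** * Exponential moment of the distances to the core *)

Section Chaining.
Variable m : nat.
Hypothesis m0 : (0 < m)%N.

(* The base of the exponential moment at time k: the exponent
   [ln (height_base k)] is of order [loop_scale m / loop_scale k]. *)
Definition height_rate k : R := (2 * (loop_scale k / loop_scale m) - 1)^-1.

Definition height_base k : R := 1 + height_rate k.

Let rateV k : (m <= k)%N -> 1 <= 2 * (loop_scale k / loop_scale m) - 1.
Proof.
move=> mk; have s0 := loop_scale_gt0 m0.
have : 1 <= loop_scale k / loop_scale m.
  by rewrite ler_pdivlMr// mul1r loop_scale_homo ?inE ?(leq_trans m0 mk).
lra.
Qed.

Let rate_gt0 k : (m <= k)%N -> 0 < height_rate k.
Proof. by move=> /rateV h; rewrite invr_gt0; lra. Qed.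

Let rate_le1 k : (m <= k)%N -> height_rate k <= 1.
Proof. by move=> /rateV h; rewrite invf_le1//; lra. Qed.

Let base_ge1 k : (m <= k)%N -> 1 <= height_base k.
Proof. by move=> /rate_gt0; rewrite /height_base; lra. Qed.

(** Let a and b be the inverse rates at k and k + 1, and r = 1/(2k). The summand -1 in [height_rate]
    turns the growth of [loop_scale] into a (1 + r) + r <= b, and this extra r absorbs the quadratic
    term r / b^2. *)
Lemma height_base_step k : (m <= k)%N ->
  height_base k.+1 * (1 + (k.*2%:R)^-1 * (height_base k.+1 - 1)) <= height_base k.
Proof.
move=> mk; have k0 : (0 < k)%N := leq_trans m0 mk.
have := rateV mk; have := rateV (leqW mk); rewrite /height_base /height_rate.
have := loop_scale_step k0; have := loop_scale_gt0 m0.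
have r0 : 0 < (k.*2%:R)^-1 :> R by rewrite invr_gt0 ltr0n double_gt0.
move: (k.*2%:R)^-1 r0 (loop_scale k) (loop_scale k.+1) (loop_scale m).
move=> r r0 s s' sm sm0 ss'.
have : s / sm * (1 + r) <= s' / sm by rewrite mulrAC ler_pM2r// invr_gt0.
move: (s / sm) (s' / sm) => y y' yy' y'1 y1.
pose a := 2 * y - 1; pose b := 2 * y' - 1; rewrite -/a -/b in y'1 y1 *.
have ab : a * (1 + r) + r <= b by rewrite /a /b; lra.
have b0 : 0 < b by lra.
have a0 : 0 < a by lra.
have ba : b^-1 * a <= 1 by rewrite mulrC ler_pdivrMr// mul1r; nra.
suff : b^-1 * (1 + r) + r * b^-1 * b^-1 <= a^-1 by lra.
rewrite -(ler_pM2l a0) divff ?gt_eqF// -(ler_pM2l b0) mulr1.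
have -> : b * (a * (b^-1 * (1 + r) + r * b^-1 * b^-1)) =
    a * (1 + r) + r * (b^-1 * a) by field; rewrite gt_eqF.
by have := ler_wpM2l (ltW r0) ba; lra.
Qed.

(** Summing over all edges reduces the control of the farthest one to a single expectation. *)
Definition height_gen k t : R := \sum_(v < k) height_base k ^+ dist_to m t v.

Lemma height_gen_ge0 k t : (m <= k)%N -> 0 <= height_gen k t.
Proof.
by move=> /base_ge1 h; apply: sumr_ge0 => v _; rewrite exprn_ge0//; lra.
Qed.

Let bernoulli (x : R) d : 0 <= x -> 1 + d%:R * x <= (1 + x) ^+ d.
Proof.
move=> x0; elim: d => [|d IH]; first by rewrite mul0r addr0 expr0.
rewrite exprS -natr1; have : 0 <= d%:R :> R by [].
by nra.
Qed.

(** The urn bound is z'^D (1 + D r (z' - 1)); Bernoulli's inequality makes it a D-th power, to which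
    [height_base_step] applies factor by factor. *)
Lemma graft_mean_height_base t v : (m <= nedges t)%N -> (v < nedges t)%N ->
  graft_mean (fun t' => height_base (nedges t).+1 ^+ dist_to m t' v) t
    <= height_base (nedges t) ^+ dist_to m t v.
Proof.
move=> mt vt; have mt' : (0 < m <= nedges t)%N by rewrite m0.
have [A [cA hA]] := dist_to_graft mt' vt.
have b1 := base_ge1 (leqW mt).
have mono : {homo (fun d => height_base (nedges t).+1 ^+ d) : a b / (a <= b)%N >-> a <= b}.
  by move=> a b ab; rewrite ler_weXn2l.
apply: le_trans (graft_mean_urn mono cA hA) _.
have k0 : 0 < (nedges t).*2%:R :> R by rewrite ltr0n double_gt0 nedges_gt0.
have := height_base_step mt.
move: (height_base _.+1) (height_base (nedges t)) b1 => z' z z1 zz.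
set D := dist_to m t v; set r := (nedges t).*2%:R^-1 in zz *.
have r0 : 0 < r by rewrite invr_gt0.
have rz : 0 <= r * (z' - 1) by rewrite mulr_ge0 ?(ltW r0)// subr_ge0.
have q0 : 0 <= z' * (1 + r * (z' - 1)) by rewrite mulr_ge0//; lra.
apply: le_trans (_ : (z' * (1 + r * (z' - 1))) ^+ D <= _); last first.
  by rewrite lerXn2r ?nnegrE// (le_trans q0 zz).
rewrite exprMn exprS.
have -> : z' ^+ D + D%:R * r * (z' * z' ^+ D - z' ^+ D) =
  z' ^+ D * (1 + D%:R * (r * (z' - 1))) by ring.
apply: ler_wpM2l; first by rewrite exprn_ge0//; lra.
exact: bernoulli.
Qed.

(** The old edges contribute no growth in mean. The new one lies at most two steps further than the
    edge [c.1] of the chosen corner; as the base is at most 2, this costs a factor 4, and each edge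
    carries 2 of the 2k corners, whence 4/k. *)
Lemma graft_mean_height_gen t : (m <= nedges t)%N ->
  graft_mean (height_gen (nedges t).+1) t <=
    (1 + 4 / (nedges t)%:R) * height_gen (nedges t) t.
Proof.
move=> mt; have mt' : (0 < m <= nedges t)%N by rewrite m0.
set k := nedges t; have k0 : 0 < k%:R :> R by rewrite ltr0n nedges_gt0.
have z1 := base_ge1 (leqW mt); have z2 := rate_le1 (leqW mt).
have -> : graft_mean (height_gen k.+1) t =
    \sum_(v < k) graft_mean (fun t' => height_base k.+1 ^+ dist_to m t' v) t +
    graft_mean (fun t' => height_base k.+1 ^+ dist_to m t' k) t.
  rewrite /graft_mean -mulr_suml -mulrDl; congr (_ * _).
  rewrite [X in _ = X + _]exchange_big -big_split /=.
  by apply: eq_bigr => c _; rewrite /height_gen big_ord_recr.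
rewrite mulrDl mul1r; apply: lerD.
  by apply: ler_sum => v _; exact: graft_mean_height_base.
apply: le_trans (_ : graft_mean (fun t' => height_base k.+1 ^+ dist_to m t' k) t <=
  (\sum_(c : corner t) 4 * height_base k ^+ dist_to m t c.1) / #|corner t|%:R) _.
  rewrite ler_pM2r ?invr_gt0 ?corner_gt0//; apply: ler_sum => c _.
  apply: le_trans (ler_weXn2l z1 (dist_to_new c mt')) _.
  have z0 : 0 <= height_base k.+1 by lra.
  rewrite -addn2 exprD mulrC; apply: ler_pM; rewrite ?exprn_ge0//.
  - by rewrite /height_base expr2; move: z2 (rate_gt0 (leqW mt)); nra.
  - rewrite lerXn2r ?nnegrE//; first by move: (base_ge1 mt); rewrite -/k; lra.
    have := height_base_step mt.
    have : 0 <= height_base k.+1 * ((k.*2%:R)^-1 * (height_base k.+1 - 1)).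
      by rewrite !mulr_ge0// subr_ge0.
    by rewrite -/k (mulrDr _ 1) mulr1; lra.
have -> : \sum_(c : corner t) 4 * height_base k ^+ dist_to m t c.1 =
    8 * height_gen k t.
  rewrite -(pair_bigA _ (fun (v : 'I_k) (b : bool) => 4 * height_base k ^+ dist_to m t v)) /=.
  rewrite /height_gen mulr_sumr; apply: eq_bigr => v _.
  by rewrite big_bool /=; ring.
rewrite card_corner -/k -muln2 natrM.
suff -> : 8 * height_gen k t / (k%:R * 2%:R) = 4 / k%:R * height_gen k t by [].
by field; rewrite gt_eqF.
Qed.

(* From [expR y >= 1 + y] and [expR (x / 2) <= 1 + x] for 0 <= x <= 1. *)
Lemma dist_to_height_gen (L : R) t v k : (m <= k)%N -> (v < k)%N ->
  (dist_to m t v)%:R / loop_scale k <=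
    4 / loop_scale m * (L + expR (- L) * height_gen k t).
Proof.
move=> mk vk; have x0 := rate_gt0 mk; have x1 := rate_le1 mk.
set x := height_rate k in x0 x1.
have sm0 := loop_scale_gt0 m0; have sk0 := loop_scale_gt0 (leq_trans m0 mk).
have ex : expR (x / 2) <= 1 + x.
  have := expR_ge1Dx (- (x / 2)); rewrite expRN => h.
  have e0 := expR_gt0 (x / 2).
  have : (1 + - (x / 2)) * expR (x / 2) <= 1.
    by rewrite -(ler_pM2r e0) mulVf ?gt_eqF// in h.
  nra.
set D := dist_to m t v; set y := D%:R * (x / 2).
have ey : expR y <= height_gen k t.
  rewrite /y expRM_natl; apply: le_trans (_ : (1 + x) ^+ D <= _).
    by rewrite lerXn2r// nnegrE ?expR_ge0//; lra.
  rewrite /height_gen (bigD1 (Ordinal vk)) //= lerDl sumr_ge0 // => i _.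
  by rewrite exprn_ge0//; move: (base_ge1 mk); lra.
(* The tangent of the exponential at the free level [L] replaces the logarithm of the moment by an
   expression linear in it, hence easy to integrate. *)
have yL : y <= L + expR (- L) * height_gen k t.
  have := expR_ge1Dx (y - L); rewrite expRD mulrC.
  have := ler_wpM2l (expR_ge0 (- L)) ey; lra.
apply: le_trans (_ : 4 / loop_scale m * y <= _); last first.
  by apply: ler_wpM2l => //; rewrite divr_ge0// ltW.
have xE : 1 <= 2 * (loop_scale k / loop_scale m) * x.
  have := rateV mk => h.
  rewrite /x /height_rate ler_pdivlMr ?mul1r; lra.
rewrite ler_pdivrMr//.
have -> : 4 / loop_scale m * y * loop_scale k =
  D%:R * (2 * (loop_scale k / loop_scale m) * x).
  by rewrite /y; field; rewrite gt_eqF.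
by rewrite ler_peMr.
Qed.

End Chaining.

End Moments.

(** * Gromov-Hausdorff distance and correspondences *)

Section Correspondence.
Variable R : realType.

Definition correspondence (X Y : metricType R) (C : X -> Y -> Prop) (r : R) : Prop :=
  [/\ forall x, exists y, C x y, forall y, exists x, C x y &
      forall x x' y y', C x y -> C x' y' -> `|mdist x x' - mdist y y'| <= r].

Section Glue.
Variables (X Y : metricType R) (C : X -> Y -> Prop) (r : R).
Hypothesis r0 : 0 < r.
Hypothesis Cr : correspondence C r.

(** Corresponding points are joined by bridges of length [r]. Crossing two bridges costs 2 r, more
    than the distortion, so neither space is shortened; and [r > 0] keeps the two copies apart. *)
Definition cross_dist (x : X) (y : Y) : R :=
  inf [set d | exists x' y', C x' y' /\ d = mdist x x' + r + mdist y' y].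

Definition glued_dist (u v : X + Y) : R :=
  match u, v with
  | inl x, inl x' => mdist x x'
  | inr y, inr y' => mdist y y'
  | inl x, inr y => cross_dist x y
  | inr y, inl x => cross_dist x y
  end.

Let cross_lb x y (a : R) :
  (forall x' y', C x' y' -> a <= mdist x x' + r + mdist y' y) -> a <= cross_dist x y.
Proof.
case: Cr => /(_ x) [y0 xy0] _ _ h; apply: lb_le_inf.
  by exists (mdist x x + r + mdist y0 y), x, y0.
by move=> _ [x' [y' [Cxy ->]]]; exact: h.
Qed.

Let cross_le x y x' y' : C x' y' -> cross_dist x y <= mdist x x' + r + mdist y' y.
Proof.
move=> Cxy; apply: ge_inf; last by exists x', y'.
exists 0 => _ [a [b [_ ->]]].
by rewrite !addr_ge0 ?mdist_ge0// ltW.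
Qed.

Let cross_ge x y : r <= cross_dist x y.
Proof.
apply: cross_lb => x' y' _; have := mdist_ge0 x x'; have := mdist_ge0 y' y; lra.
Qed.

Let glued_xx u : glued_dist u u = 0.
Proof. by case: u => x /=; exact: mdistxx. Qed.

Let glued_eq0 u v : glued_dist u v = 0 -> u = v.
Proof.
case: u v => [x|y] [x'|y'] /=.
- by move/mdist_positivity ->.
- by move=> h; exfalso; have := cross_ge x y'; rewrite h leNgt r0.
- by move=> h; exfalso; have := cross_ge x' y; rewrite h leNgt r0.
- by move/mdist_positivity ->.
Qed.

Let glued_sym u v : glued_dist u v = glued_dist v u.
Proof. by case: u v => [x|y] [x'|y'] //=; exact: metric_sym. Qed.

Let cross_triangle_l x x' y : cross_dist x y <= mdist x x' + cross_dist x' y.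
Proof.
rewrite -lerBlDl; apply: cross_lb => a b Cab; rewrite lerBlDl.
have := cross_le x y Cab; have := metric_triangle x x' a; lra.
Qed.

Let cross_triangle_r x y y' : cross_dist x y <= cross_dist x y' + mdist y' y.
Proof.
rewrite -lerBlDr; apply: cross_lb => a b Cab; rewrite lerBlDr.
have := cross_le x y Cab; have := metric_triangle b y' y; lra.
Qed.

Let cross_triangle_x x x' y : mdist x x' <= cross_dist x y + cross_dist x' y.
Proof.
rewrite -lerBlDr; apply: cross_lb => a b Cab; rewrite lerBlDr -lerBlDl.
apply: cross_lb => a' b' Cab'; case: Cr => _ _ /(_ _ _ _ _ Cab Cab').
rewrite ler_norml => /andP[_ h].
have := metric_triangle x a x'; have := metric_triangle a a' x'.
have := metric_triangle b y b'; rewrite (metric_sym a' x') (metric_sym y b'). move: h r0; lra.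
Qed.

Let cross_triangle_y x y y' : mdist y y' <= cross_dist x y + cross_dist x y'.
Proof.
rewrite -lerBlDr; apply: cross_lb => a b Cab; rewrite lerBlDr -lerBlDl.
apply: cross_lb => a' b' Cab'; case: Cr => _ _ /(_ _ _ _ _ Cab Cab').
rewrite ler_norml => /andP[h _].
have := metric_triangle y b y'; have := metric_triangle b b' y'.
have := metric_triangle a x a'; rewrite (metric_sym y b) (metric_sym a x); move: h r0; lra.
Qed.

Let glued_triangle v u w : glued_dist u w <= glued_dist u v + glued_dist v w.
Proof.
case: u v w => [x|y] [x'|y'] [x''|y''] /=.
- exact: metric_triangle.
- exact: cross_triangle_l.
- exact: cross_triangle_x.
- exact: cross_triangle_r.
- by rewrite (addrC (cross_dist _ _)) (metric_sym x'); exact: cross_triangle_l.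
- exact: cross_triangle_y.
- by rewrite addrC (metric_sym y); exact: cross_triangle_r.
- exact: metric_triangle.
Qed.

Lemma glue_correspondence : exists (Z : metricType R) (f : X -> Z) (g : Y -> Z),
  [/\ isometric_embedding f, isometric_embedding g &
      forall x y, C x y -> mdist (f x) (g y) <= r].
Proof.
pose Z : metricType R := HB.pack (X + Y)%type
  (isMetric.Build R (X + Y)%type glued_xx glued_eq0 glued_sym glued_triangle).
exists Z, (inl : X -> Z), (inr : Y -> Z); split => // x y Cxy.
have := cross_le x y Cxy; rewrite !mdistxx add0r addr0.
exact.
Qed.

End Glue.

Lemma hausdorff_dist_ge0 (Z : metricType R) (A B : set Z) : 0 <= hausdorff_dist A B.
Proof.
rewrite /hausdorff_dist; set S := (X in inf X).
have [->|/set0P S0] := eqVneq S set0; first by rewrite inf0.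
by apply: lb_le_inf => // r [/ltW].
Qed.

Lemma hausdorff_dist_le (Z : metricType R) (A B : set Z) (r : R) : 0 < r ->
  (forall a, A a -> exists2 b, B b & mdist a b < r) ->
  (forall b, B b -> exists2 a, A a & mdist a b < r) -> hausdorff_dist A B <= r.
Proof.
move=> r0 AB BA; apply: ge_inf; first by exists 0 => s [/ltW].
split => // [a /AB[b Bb ab]|b /BA[a Aa ab]].
  by exists b => //; rewrite ballEmdist /= metric_sym.
by exists a => //; rewrite ballEmdist.
Qed.

Lemma gh_dist_ge0 (X Y : compact_metric_space R) : 0 <= gh_dist X Y.
Proof.
rewrite /gh_dist; set S := (X in inf X).
have [->|/set0P S0] := eqVneq S set0; first by rewrite inf0.
by apply: lb_le_inf => // r [Z [f [g [_ _ ->]]]]; exact: hausdorff_dist_ge0.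
Qed.

Lemma correspondence_gh_dist (X Y : compact_metric_space R) C (r : R) : 0 < r ->
  @correspondence X Y C r -> gh_dist X Y <= 2 * r.
Proof.
move=> r0 Cr; have [Z [f [g [fi gi fg]]]] := glue_correspondence r0 Cr.
have r2 : r < 2 * r by lra.
apply: le_trans (_ : hausdorff_dist (range f) (range g) <= _).
  apply: ge_inf; last by exists Z, f, g.
  by exists 0 => s [Z' [f' [g' [_ _ ->]]]]; exact: hausdorff_dist_ge0.
case: Cr => CX CY _; apply: hausdorff_dist_le; first by rewrite mulr_gt0.
  move=> _ [x _ <-]; have [y xy] := CX x.
  by exists (g y); [exists y|exact: le_lt_trans (fg _ _ xy) r2].
move=> _ [y _ <-]; have [x xy] := CY y.
by exists (f x); [exists x|exact: le_lt_trans (fg _ _ xy) r2].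
Qed.

Lemma compact_metric_bounded (X : compact_metric_space R) :
  exists D : R, forall x y : X, mdist x y <= D.
Proof.
have [x0 _] := @cms_nonempty R X.
have cont : continuous (fun x : X => mdist x0 x : R^o).
  move=> x; apply/cvgrPdist_lt => e e0.
  apply/metricType_numDomainType.nbhs_mdistP; exists e => //= y xy.
  apply: le_lt_trans xy; rewrite ler_norml.
  have := metric_triangle x0 x y; have := metric_triangle x0 y x.
  by rewrite (metric_sym y x); lra.
have /compact_bounded[M [_ MB]] :
    compact ((fun x : X => mdist x0 x : R^o) @` [set: X]).
  by apply: continuous_compact; [exact: continuous_subspaceT|exact: cms_compact].
have MB' x : mdist x0 x <= M + 1.
  apply: le_trans (ler_norm _) _; apply: (MB (M + 1)); first by rewrite ltrDl.
  by exists x.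
exists (M + 1 + (M + 1)) => x y; apply: le_trans (metric_triangle x x0 y) _.
by rewrite lerD// metric_sym.
Qed.

(** As [inf] is 0 on the empty set, [gh_dist X Y < e] says something only once both infima are known
    to be over nonempty sets; the boundedness of compact spaces ensures this. Points whose images
    are closer than the Hausdorff radius then correspond. *)
Lemma gh_dist_correspondence (X Y : compact_metric_space R) (e : R) :
  gh_dist X Y < e -> exists C, @correspondence X Y C (2 * e).
Proof.
have [DX hX] := compact_metric_bounded X; have [DY hY] := compact_metric_bounded Y.
have [x0 _] := @cms_nonempty R X; have [y0 _] := @cms_nonempty R Y.
have DX0 : 0 <= DX by apply: le_trans (hX x0 x0); exact: mdist_ge0.
have DY0 : 0 <= DY by apply: le_trans (hY y0 y0); exact: mdist_ge0.
(* Relating all pairs of points provides one common embedding, hence an element for the outer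
   infimum. *)
have Ctot : @correspondence X Y (fun _ _ => True) (DX + DY + 1).
  split; [by exists y0|by exists x0|move=> x x' y y' _ _; rewrite ler_norml].
  have := hX x x'; have := hY y y'; have := mdist_ge0 x x'; have := mdist_ge0 y y'.
  by lra.
have D1 : 0 < DX + DY + 1 by lra.
have [Z0 [f0 [g0 [fi0 gi0 _]]]] := glue_correspondence D1 Ctot.
move=> /inf_lt[|d [Z [f [g [fi gi ->]]]]].
  by exists (hausdorff_dist (range f0) (range g0)), Z0, f0, g0.
pose r := mdist (f x0) (g y0) + DX + DY + 1.
have r0 : 0 < r by rewrite /r; have := mdist_ge0 (f x0) (g y0); lra.
have rb x y : mdist (f x) (g y) < r.
  have := metric_triangle (f x) (f x0) (g y); have := metric_triangle (f x0) (g y0) (g y).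
  by rewrite fi gi /r; have := hX x x0; have := hY y0 y; lra.
move=> /inf_lt[|s [s0 sA sB] se].
  exists r; split => // _ [x _ <-].
    by exists (g y0); [exists y0|rewrite ballEmdist /= metric_sym].
  by exists (f x0); [exists x0|rewrite ballEmdist /=].
exists (fun x y => mdist (f x) (g y) < s); split.
- move=> x; have [_ [y _ <-]] : (\bigcup_(b in range g) ball b s) (f x).
    by apply: sA; exists x.
  by rewrite ballEmdist /= metric_sym; exists y.
- move=> y; have [_ [x _ <-]] : (\bigcup_(b in range f) ball b s) (g y).
    by apply: sB; exists y.
  by rewrite ballEmdist /=; exists x.
- move=> x x' y y' xy xy'; rewrite -fi -gi ler_norml.
  have := metric_triangle (f x) (g y) (f x'); have := metric_triangle (g y) (g y') (f x').
  have := metric_triangle (g y) (f x) (g y'); have := metric_triangle (f x) (f x') (g y').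
  by rewrite (metric_sym (g y')) (metric_sym (g y) (f x)); lra.
Qed.

Lemma correspondence_comp (X Y Z : metricType R) C C' (r s : R) :
  @correspondence X Y C r -> @correspondence Y Z C' s ->
  @correspondence X Z (fun x z => exists2 y, C x y & C' y z) (r + s).
Proof.
move=> [CX CY Cr] [CY' CZ Cs]; split.
- by move=> x; have [y xy] := CX x; have [z yz] := CY' y; exists z, y.
- by move=> z; have [y yz] := CZ z; have [x xy] := CY y; exists x, y.
- move=> x x' z z' [y xy yz] [y' xy' yz'].
  rewrite -(subrKA (mdist y y')); apply: le_trans (ler_normD _ _) _.
  by apply: lerD; [exact: Cr xy xy'|exact: Cs yz yz'].
Qed.

Lemma correspondence_sym (X Y : metricType R) C (r : R) :
  @correspondence X Y C r -> @correspondence Y X (fun y x => C x y) r.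
Proof.
move=> [CX CY Cr]; split => // y y' x x' xy xy'.
by rewrite distrC; exact: Cr.
Qed.

(** Composing correspondences avoids gluing ambient spaces; the lost factor 4 is harmless for the
    topology. *)
Lemma gh_dist_triangle_lt (X Y Z : compact_metric_space R) (e f : R) :
  gh_dist X Y < e -> gh_dist Y Z < f -> gh_dist X Z <= 4 * (e + f).
Proof.
move=> XY YZ; have e0 := le_lt_trans (gh_dist_ge0 _ _) XY.
have f0 := le_lt_trans (gh_dist_ge0 _ _) YZ.
have [C hC] := gh_dist_correspondence XY; have [C' hC'] := gh_dist_correspondence YZ.
apply: le_trans (correspondence_gh_dist _ (correspondence_comp hC hC')) _; lra.
Qed.

Lemma gh_dist_sym_lt (X Y : compact_metric_space R) (e : R) :
  gh_dist X Y < e -> gh_dist Y X <= 4 * e.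
Proof.
move=> XY; have e0 := le_lt_trans (gh_dist_ge0 _ _) XY.
have [C /correspondence_sym hC] := gh_dist_correspondence XY.
apply: le_trans (correspondence_gh_dist _ hC) _; lra.
Qed.

End Correspondence.

(** * Completion of a totally bounded pseudometric *)

Section LimitSpace.
Variables (R : realType) (d : nat -> nat -> R).
Hypothesis dxx : forall e, d e e = 0.
Hypothesis d_sym : forall e f, d e f = d f e.
Hypothesis d_triangle : forall f e g, d e g <= d e f + d f g.
Hypothesis d_tb : forall r, 0 < r ->
  exists N : nat, forall v, exists2 u, (u < N)%N & d v u < r.

(* A point of the completion of the pseudometric space (nat, d) is represented
   by its distances to the points of nat; this also takes care of the quotient. *)
Record limit_point := LimitPoint {
  dist_from :> nat -> R;
  dist_from_lipschitz : forall e f, dist_from e <= dist_from f + d e f;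
  dist_from_katetov : forall e f, d e f <= dist_from e + dist_from f;
  dist_from_inf : forall r, 0 < r -> exists e, dist_from e < r }.

HB.instance Definition _ := gen_eqMixin limit_point.
HB.instance Definition _ := gen_choiceMixin limit_point.

Implicit Types x y z : limit_point.

Let dist_from_ge0 x e : 0 <= x e.
Proof. by have := dist_from_katetov x e e; rewrite dxx; lra. Qed.

Lemma limit_point_eq x y : (x : nat -> R) = y -> x = y.
Proof.
case: x y => [x x1 x2 x3] [y y1 y2 y3] /= xy; subst y.
by congr LimitPoint; exact: Prop_irrelevance.
Qed.

Definition limit_dist x y : R := inf (range (fun e => x e + y e)).

Let limit_dist_le x y e : limit_dist x y <= x e + y e.
Proof.
apply: ge_inf; last by exists e.
by exists 0 => _ [f _ <-]; rewrite addr_ge0.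
Qed.

Let limit_dist_lb x y (a : R) : (forall e, a <= x e + y e) -> a <= limit_dist x y.
Proof.
by move=> h; apply: lb_le_inf; [exists (x 0%N + y 0%N), 0%N|move=> _ [e _ <-]].
Qed.

Let limit_dist_ge0 x y : 0 <= limit_dist x y.
Proof. by apply: limit_dist_lb => e; rewrite addr_ge0. Qed.

Let limit_distxx x : limit_dist x x = 0.
Proof.
apply/eqP; rewrite eq_le limit_dist_ge0 andbT; apply/ler_addgt0Pr => r r0.
have [e xe] := dist_from_inf x (divr_gt0 r0 (ltr0n R 2)).
by apply: le_trans (limit_dist_le x x e) _; move: xe; lra.
Qed.

Let limit_dist_sym x y : limit_dist x y = limit_dist y x.
Proof.
by congr inf; apply: eq_imagel => e _; rewrite addrC.
Qed.

Let limit_dist_lip x y e : x e <= y e + limit_dist x y.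
Proof.
rewrite -lerBlDl; apply: limit_dist_lb => f; rewrite lerBlDl.
have := dist_from_lipschitz x e f; have := dist_from_katetov y e f; lra.
Qed.

Let limit_dist_eq0 x y : limit_dist x y = 0 -> x = y.
Proof.
move=> xy0; apply: limit_point_eq; apply/funext => e; apply/eqP; rewrite eq_le.
have := limit_dist_lip x y e; have := limit_dist_lip y x e.
by rewrite (limit_dist_sym y x) xy0 !addr0 => -> ->.
Qed.

Let limit_dist_triangle y x z : limit_dist x z <= limit_dist x y + limit_dist y z.
Proof.
rewrite -lerBlDr; apply: limit_dist_lb => e; rewrite lerBlDr -lerBlDl.
apply: limit_dist_lb => f; rewrite lerBlDl.
have := limit_dist_le x z e; have := dist_from_lipschitz z e f.
have := dist_from_katetov y e f; lra.
Qed.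

Let limit_metric : metricType R := HB.pack limit_point
  (isMetric.Build R limit_point limit_distxx limit_dist_eq0 limit_dist_sym
     limit_dist_triangle).

Let mdistE (x y : limit_metric) : mdist x y = limit_dist x y.
Proof. by []. Qed.

Let embed_lipschitz g e f : d g e <= d g f + d e f.
Proof. by rewrite (d_sym e f). Qed.

Let embed_katetov g e f : d e f <= d g e + d g f.
Proof. by rewrite (d_sym g e). Qed.

Let embed_inf g r : 0 < r -> exists e, d g e < r.
Proof. by exists g; rewrite dxx. Qed.

Definition limit_embed (g : nat) : limit_point :=
  LimitPoint (embed_lipschitz g) (embed_katetov g) (@embed_inf g).

Let limit_dist_embed x e : limit_dist x (limit_embed e) = x e.
Proof.
apply/eqP; rewrite eq_le; apply/andP; split.
  by apply: le_trans (limit_dist_le _ _ e) _; rewrite /= dxx addr0.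
apply: limit_dist_lb => f /=; exact: dist_from_lipschitz.
Qed.

Section Ultrafilter.
Variable F : set_system limit_metric.
Hypothesis FU : UltraFilter F.

(** Otherwise the ultrafilter would contain the complements of the balls around all [u < N], and so
    their intersection, which total boundedness makes empty. *)
Let ultra_net r : 0 < r -> exists e, F [set x : limit_point | x e < r].
Proof.
move=> r0; have [N hN] := d_tb (divr_gt0 r0 (ltr0n R 2)).
apply: contrapT => /forallNP h.
have hF n : F [set x : limit_point | forall u, (u < n)%N -> ~ x u < r].
  elim: n => [|n IH]; first by apply: filterS filterT.
  have [/h//|Fn] := in_ultra_setVsetC [set x : limit_point | x n < r] FU.
  apply: filterS (filterI IH Fn) => x [xl xn] u; rewrite ltnS leq_eqVlt.
  by case/predU1P => [->|/xl].
have /filter_ex[x /= xN] := hF N.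
have [e xe] := dist_from_inf x (divr_gt0 r0 (ltr0n R 2)).
have [u uN eu] := hN e; apply: (xN u uN).
apply: le_lt_trans (dist_from_lipschitz x u e) _.
by rewrite d_sym; move: xe eu; lra.
Qed.

(** The limit of [x e] along [F]; these coordinatewise limits are the distances from the limit point
    sought. *)
Let lim_val e : R := inf [set a | F [set x : limit_point | x e < a]].

Let lim_set_lb e : has_lbound [set a | F [set x : limit_point | x e < a]].
Proof.
exists 0 => a /= /filter_ex[x /= /ltW]; exact: le_trans.
Qed.

Let lim_val_near e r : 0 < r -> F [set x : limit_point | `|x e - lim_val e| <= r].
Proof.
move=> r0; have Fup : F [set x : limit_point | x e < lim_val e + r].
  have /inf_lt[|a /= Fa ar] : lim_val e < lim_val e + r by rewrite ltrDl.
    have [u Fu] := ultra_net ltr01; exists (1 + d e u).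
    apply: filterS Fu => x /= xu; apply: le_lt_trans (dist_from_lipschitz x e u) _.
    by rewrite ltrD2r.
  by apply: filterS Fa => x /= xa; exact: lt_trans ar.
have [Flo|Fhi] := in_ultra_setVsetC [set x : limit_point | x e < lim_val e - r] FU.
  have := ge_inf (lim_set_lb e) Flo; rewrite -/(lim_val e).
  by rewrite leNgt ltrBlDr ltrDl r0.
apply: filterS (filterI Fup Fhi) => x /= [x1 /negP]; rewrite -leNgt => x2.
by rewrite ler_norml; move: x1 x2; lra.
Qed.

Let lim_ex (es : seq nat) r : 0 < r ->
  exists x : limit_point, forall e, e \in es -> `|x e - lim_val e| <= r.
Proof.
move=> r0; suff /filter_ex : F [set x : limit_point | forall e, e \in es ->
  `|x e - lim_val e| <= r] by [].
elim: es => [|e es IH]; first by apply: filterS filterT.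
apply: filterS (filterI (lim_val_near e r0) IH) => x [xe xs] f.
by rewrite inE => /predU1P[->|/xs].
Qed.

Let lim_lipschitz e f : lim_val e <= lim_val f + d e f.
Proof.
apply/ler_addgt0Pr => r r0.
have [x hx] := lim_ex [:: e; f] (divr_gt0 r0 (ltr0n R 2)).
have := hx e (mem_head _ _); have := hx f (mem_last _ [:: f]).
have := dist_from_lipschitz x e f; rewrite !ler_norml; lra.
Qed.

Let lim_katetov e f : d e f <= lim_val e + lim_val f.
Proof.
apply/ler_addgt0Pr => r r0.
have [x hx] := lim_ex [:: e; f] (divr_gt0 r0 (ltr0n R 2)).
have := hx e (mem_head _ _); have := hx f (mem_last _ [:: f]).
have := dist_from_katetov x e f; rewrite !ler_norml; lra.
Qed.

Let lim_inf r : 0 < r -> exists e, lim_val e < r.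
Proof.
move=> r0; have [e Fe] := ultra_net (divr_gt0 r0 (ltr0n R 2)); exists e.
apply: le_lt_trans (_ : r / 2 < r); last by lra.
by rewrite /lim_val; apply: ge_inf Fe; exact: lim_set_lb.
Qed.

Lemma ultra_limit_cvg : exists z : limit_metric, F --> z.
Proof.
exists (LimitPoint lim_lipschitz lim_katetov lim_inf).
apply/metricType_numDomainType.fcvgrPdist_lt => r r0.
have r3 : 0 < r / 3 by lra.
(* One coordinate suffices: the distance from z to x is at most z e + x e, hence at most 2 z e +
   r/3. *)
have [e ze] := lim_inf r3.
apply: filterS (lim_val_near e r3) => x /=; rewrite ler_norml => xe.
rewrite mdistE; apply: le_lt_trans (limit_dist_le _ _ e) _ => /=.
by move: ze xe; lra.
Qed.

End Ultrafilter.

Lemma limit_space : exists (M : compact_metric_space R) (i : nat -> M),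
  (forall e f, mdist (i e) (i f) = d e f) /\
  (forall (x : M) (r : R), 0 < r -> exists e, mdist x (i e) < r).
Proof.
have ne : [set: limit_metric] !=set0 by exists (limit_embed 0%N).
have co : compact [set: limit_metric].
  rewrite compact_ultra => F FU _; have [z Fz] := ultra_limit_cvg FU.
  by exists z.
exists (CompactMetricSpace ne co), (limit_embed : nat -> limit_metric); split.
  by move=> e f; rewrite mdistE limit_dist_embed.
move=> x r r0; have [e xe] := dist_from_inf (x : limit_point) r0.
by exists e; rewrite mdistE limit_dist_embed.
Qed.

End LimitSpace.

(** * Scaling limit of a growing sequence of pseudometrics *)

Lemma near_forall_lt (T : Type) (F : set_system T) (FF : Filter F) (N : nat)
    (Q : nat -> T -> Prop) :
  (forall u, (u < N)%N -> \forall x \near F, Q u x) ->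
  \forall x \near F, forall u, (u < N)%N -> Q u x.
Proof.
elim: N => [|N IH] h; first by near=> x.
have h1 : \forall x \near F, forall u, (u < N)%N -> Q u x.
  by apply: IH => u uN; apply: h; exact: ltnW.
have h2 := h N (ltnSn N).
near=> x => u; rewrite ltnS leq_eqVlt => /predU1P[->|uN].
  by near: x.
by move: u uN; near: x.
Unshelve. all: by end_near. Qed.

Lemma unbounded_between (n : nat -> nat) (J k : nat) :
  (forall K, \forall j \near \oo, (K < n j)%N) -> (n J <= k)%N ->
  exists2 j, (J <= j)%N & (n j <= k < n j.+1)%N.
Proof.
move=> noo nJ; have ex : exists j, (k < n (J + j))%N.
  have [j0 _ h] := noo k; exists j0; apply: h => /=; exact: leq_addl.
case: (ex_minnP ex) => -[|j] kj jmin; first by rewrite addn0 ltnNge nJ in kj.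
exists (J + j)%N; first exact: leq_addr.
rewrite -addnS kj andbT leqNgt; apply/negP => /jmin; by rewrite ltnn.
Qed.

Section ScalingLimit.
Variables (R : realType) (dd : nat -> nat -> nat -> R).
Variables (m n : nat -> nat) (s q E a b : nat -> R).
Hypothesis ddxx : forall k e, dd k e e = 0.
Hypothesis dd_ge0 : forall k e f, 0 <= dd k e f.
Hypothesis dd_sym : forall k e f, dd k e f = dd k f e.
Hypothesis dd_triangle : forall j k f e g, (m j <= k)%N -> (f < k)%N ->
  dd k e g <= dd k e f + dd k f g.
Hypothesis dd_mono : forall j k k' e f, (m j <= k)%N -> (k <= k')%N ->
  (e < k)%N -> (f < k)%N -> dd k e f <= dd k' e f.
Hypothesis m_homo : {homo m : i j / (i <= j)%N}.
Hypothesis mn : forall j, (m j <= n j)%N.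
Hypothesis m_oo : forall K, \forall j \near \oo, (K < m j)%N.
Hypothesis s_gt0 : forall j, 0 < s (n j).
Hypothesis q_gt0 : forall k, 0 < q k.
Hypothesis E_ge0 : forall j, 0 <= E j.
Hypothesis E_sum : cvgn (series E).
Hypothesis dd_incr : forall j e f, (e < m j)%N -> (f < m j)%N ->
  dd (n j.+1) e f / s (n j.+1) <= dd (n j) e f / s (n j) + E j.
Hypothesis dd_net : forall j v, (v < n j.+1)%N ->
  exists2 u, (u < m j)%N & dd (n j.+1) v u / s (n j.+1) <= E j.
Hypothesis a_lb : forall j k, (n j <= k < n j.+1)%N -> a j <= s (n j) / q k.
Hypothesis b_ub : forall j k, (n j <= k < n j.+1)%N -> s (n j.+1) / q k <= b j.
Hypothesis a_cvg : a @ \oo --> (1 : R).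
Hypothesis b_cvg : b @ \oo --> (1 : R).

Let x j e f : R := dd (n j) e f / s (n j).
Let S j : R := series E j.
Let Soo : R := limn (series E).

Let S_step j : S j.+1 = S j + E j.
Proof. by rewrite /S /series /= big_nat_recr. Qed.

Let S_homo : {homo S : i j / (i <= j)%N >-> i <= j}.
Proof. by apply/nondecreasing_seqP => j; rewrite S_step lerDl. Qed.

Let S_le j : S j <= Soo.
Proof. exact: nondecreasing_cvgn_le. Qed.

Let x_ge0 j e f : 0 <= x j e f.
Proof. by rewrite divr_ge0// ltW. Qed.

Let x_triangle j f e g : (f < n j)%N -> x j e g <= x j e f + x j f g.
Proof.
by move=> fn; rewrite -mulrDl ler_pM2r ?invr_gt0//; exact: dd_triangle (mn j) _.
Qed.

(** A deterministic form of supermartingale convergence: once both indices are in the core, [S - x]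
    is nondecreasing, and it is bounded by [Soo] because [x] is nonnegative. *)
Let x_cvg e f : cvgn (fun j => x j e f).
Proof.
have [J _ hJ] := m_oo (maxn e f).
pose y j := S (J + j)%N - x (J + j)%N e f.
have y_homo : nondecreasing_seq y.
  apply/nondecreasing_seqP => j; rewrite /y addnS S_step.
  have : (maxn e f < m (J + j))%N by apply: hJ => /=; exact: leq_addr.
  rewrite gtn_max => /andP[eJ fJ].
  by have := dd_incr eJ fJ; rewrite -/(x _ e f) -/(x _ e f); lra.
have y_bnd : has_ubound (range y).
  exists Soo => _ [j _ <-]; rewrite /y.
  by have := S_le (J + j)%N; have := x_ge0 (J + j)%N e f; lra.
have y_cvg : cvgn y by exact: nondecreasing_is_cvgn.
have xE : (fun j => x (J + j)%N e f) = (fun j => S (J + j)%N - y j).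
  by apply/funext => j; rewrite /y; ring.
apply/(cvg_ex _).
have Sc : (fun j => S (J + j)%N) @ \oo --> Soo.
  have := E_sum; rewrite -(cvg_shiftn J) => h.
  by under eq_fun do rewrite addnC.
exists (Soo - limn y).
rewrite -(cvg_shiftn J).
have -> : [sequence x (n0 + J)%N e f]_n0 = (fun j => S (J + j)%N - y j).
  by rewrite -xE; apply/funext => j /=; rewrite addnC.
exact: cvgB.
Qed.

Let doo e f : R := limn (fun j => x j e f).

Let x_doo e f : (fun j => x j e f) @ \oo --> doo e f.
Proof. exact: x_cvg. Qed.

Let dooxx e : doo e e = 0.
Proof.
apply: cvg_lim => //; under eq_fun do rewrite /x ddxx mul0r.
exact: cvg_cst.
Qed.

Let doo_sym e f : doo e f = doo f e.
Proof. by rewrite /doo; under eq_fun do rewrite /x dd_sym. Qed.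

Let doo_triangle f e g : doo e g <= doo e f + doo f g.
Proof.
have h : (fun j => x j e f + x j f g) @ \oo --> doo e f + doo f g.
  by apply: cvgD; exact: x_doo.
rewrite -(cvg_lim (@Rhausdorff R) h).
apply: ler_lim; [exact: x_cvg|by apply: cvgP h|].
apply: filterS (m_oo f) => j fm; apply: x_triangle; exact: leq_trans fm (mn j).
Qed.

(** Each level descended costs its error twice: once to move to the smaller core, once for the
    growth of the remaining distance up to the current level. *)
Let core_net i j v : (i <= j)%N -> (v < m j)%N ->
  exists2 u, (u < m i)%N & x j v u <= 2 * (S j - S i).
Proof.
move=> ij; rewrite -(subnKC ij); move: (j - i)%N => l; elim: l v => [|l IH] v.
  by rewrite addn0 => vi; exists v => //; rewrite /x ddxx mul0r subrr mulr0.
rewrite addnS => vm; have [w wm xw] := dd_net (leq_trans vm (mn _)).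
have [u um xu] := IH w wm; exists u => //.
have ui : (u < m (i + l))%N by apply: leq_trans um _; apply: m_homo; exact: leq_addr.
have wn : (w < n (i + l).+1)%N.
  by apply: leq_trans wm _; apply: leq_trans (mn _); apply: m_homo.
have := dd_incr wm ui; have := x_triangle v u wn.
by rewrite S_step; move: xw xu; rewrite /x; lra.
Qed.

Let net i j v : (i < j)%N -> (v < n j)%N ->
  exists2 u, (u < m i)%N & x j v u <= 2 * (Soo - S i).
Proof.
case: j => // j; rewrite ltnS => ij vn; have [w wm xw] := dd_net vn.
have [u um xu] := core_net ij wm; exists u => //.
have ui : (u < m j)%N by apply: leq_trans um _; exact: m_homo.
have wn : (w < n j.+1)%N.
  by apply: leq_trans wm _; apply: leq_trans (mn _); apply: m_homo.
have := dd_incr wm ui; have := x_triangle v u wn.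
have := S_le j.+1; have := E_ge0 j.
by rewrite S_step; move: xw xu; rewrite /x; lra.
Qed.

Let tail_lt r : 0 < r -> exists i, Soo - S i < r.
Proof.
move=> r0; have /cvgrPdist_lt /(_ r r0) [i _ hi] := E_sum.
by exists i; apply: le_lt_trans (ler_norm _) (hi i (leqnn i)).
Qed.

(** The core of index [i] is a net at all later levels. As it is finite, a strict lower bound on all
    the limit distances from [v] to it would hold simultaneously at some late level, against
    [net]. *)
Let doo_tb r : 0 < r -> exists N, forall v, exists2 u, (u < N)%N & doo v u < r.
Proof.
move=> r0; have r4 : 0 < r / 4 by rewrite divr_gt0.
have [i hi] := tail_lt r4; exists (m i) => v.
apply: contrapT => h.
have h' u : (u < m i)%N -> r <= doo v u.
  by move=> um; rewrite leNgt; apply/negP => lt; apply: h; exists u.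
have : \forall j \near \oo, forall u, (u < m i)%N -> r / 2 < x j v u.
  apply: near_forall_lt => u um; have := @x_doo v u => /cvgr_gt; apply.
  by apply: lt_le_trans (h' u um); rewrite ltr_pdivrMr// ltr_pMr// ltr1n.
move=> lo; have vm := m_oo v; have ji : \forall j \near \oo, (i < j)%N.
  by exists i.+1.
have [j [/= [lo' vm'] ij]] := filter_ex (filterI (filterI lo vm) ji).
have [u um] := net ij (leq_trans vm' (mn j)).
by have := lo' u um; move: hi; lra.
Qed.

Let y k e f : R := dd k e f / q k.

Let y_ub j k e f : (n j <= k < n j.+1)%N -> (e < k)%N -> (f < k)%N ->
  y k e f <= b j * x j.+1 e f.
Proof.
move=> jk ek fk; have /andP[nk kn] := jk.
have mk : (m j <= k)%N := leq_trans (mn j) nk.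
apply: le_trans (_ : s (n j.+1) / q k * x j.+1 e f <= _); last first.
  by apply: ler_wpM2r => //; exact: b_ub.
have -> : s (n j.+1) / q k * x j.+1 e f = dd (n j.+1) e f / q k.
  by rewrite /x; field; rewrite !gt_eqF.
rewrite ler_pM2r ?invr_gt0//; exact: dd_mono mk (ltnW kn) _ _.
Qed.

Let y_lb j k e f : (n j <= k < n j.+1)%N -> (e < n j)%N -> (f < n j)%N ->
  a j * x j e f <= y k e f.
Proof.
move=> jk ek fk; have /andP[nk kn] := jk.
apply: le_trans (_ : s (n j) / q k * x j e f <= _).
  by apply: ler_wpM2r => //; exact: a_lb.
have -> : s (n j) / q k * x j e f = dd (n j) e f / q k.
  by rewrite /x; field; rewrite !gt_eqF.
rewrite ler_pM2r ?invr_gt0//; exact: dd_mono (mn j) nk _ _.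
Qed.

Let n_oo K : \forall j \near \oo, (K < n j)%N.
Proof. by apply: filterS (m_oo K) => j /leq_trans; apply. Qed.

Let near_levels (Q : nat -> Prop) :
  (\forall j \near \oo, forall k, (n j <= k < n j.+1)%N -> Q k) ->
  \forall k \near \oo, Q k.
Proof.
move=> [J _ hJ]; exists (n J) => // k /= nk.
have [j Jj jk] := unbounded_between n_oo nk.
exact: hJ jk.
Qed.

Let y_cvg e f : (fun k => y k e f) @ \oo --> doo e f.
Proof.
have bx : (fun j => b j * x j.+1 e f) @ \oo --> doo e f.
  rewrite -[doo e f]mul1r; apply: cvgM => //.
  by have := @x_doo e f; rewrite -cvg_shiftS.
have ax : (fun j => a j * x j e f) @ \oo --> doo e f.
  by rewrite -[doo e f]mul1r; apply: cvgM.
apply/cvgrPdist_lt => r r0; apply: near_levels.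
have bx' : \forall j \near \oo, b j * x j.+1 e f < doo e f + r.
  by apply: (cvgr_lt _ bx); rewrite ltrDl.
have ax' : \forall j \near \oo, doo e f - r < a j * x j e f.
  by apply: (cvgr_gt _ ax); rewrite ltrBlDr ltrDl.
near=> j => k jk; have /andP[nk kn] := jk.
have : (maxn e f < n j)%N by near: j; exact: n_oo.
rewrite gtn_max => /andP[en fn].
have := y_ub jk (leq_trans en nk) (leq_trans fn nk); have := y_lb jk en fn.
have : b j * x j.+1 e f < doo e f + r by near: j.
have : doo e f - r < a j * x j e f by near: j.
by rewrite ltr_norml; move: (y k e f) => yk *; apply/andP; split; lra.
Unshelve. all: by end_near. Qed.

Let y_net r : 0 < r -> exists i, \forall k \near \oo, forall v, (v < k)%N ->
  exists2 u, (u < m i)%N & y k v u < r.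
Proof.
move=> r0; have r4 : 0 < r / 4 by rewrite divr_gt0.
have [i hi] := tail_lt r4; exists i; apply: near_levels.
have b2 : \forall j \near \oo, b j < 2 by apply: (cvgr_lt _ b_cvg); rewrite ltr1n.
near=> j => k jk v vk; have /andP[nk kn] := jk.
have ij : (i < j.+1)%N by near: j; exists i.
have [u um xu] := net ij (ltn_trans vk kn); exists u => //.
have uk : (u < k)%N.
  by apply: leq_trans um _; apply: leq_trans nk; apply: leq_trans (mn j); exact: m_homo.
apply: le_lt_trans (y_ub jk vk uk) _.
have bj : b j < 2 by near: j.
apply: le_lt_trans (_ : 2 * x j.+1 v u < r); last by move: hi xu; lra.
by apply: ler_wpM2r => //; exact: ltW.
Unshelve. all: by end_near. Qed.

(** [v] and [z] correspond when both are near a common [u] of a fixed finite set, on which the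
    rescaled distances converge uniformly. The errors add up to 2 (r/8) + 2 (r/4) + r/8 < r. *)
Lemma scaling_limit : exists M : compact_metric_space R,
  forall r, 0 < r -> \forall k \near \oo,
    exists C : nat -> M -> Prop,
    [/\ forall v, (v < k)%N -> exists z, C v z,
        forall z, exists2 v, (v < k)%N & C v z,
        forall v z, C v z -> (v < k)%N &
        forall v v' z z', C v z -> C v' z' ->
          `|dd k v v' / q k - mdist z z'| <= r].
Proof.
have [M [emb [embE dense]]] := limit_space dooxx doo_sym doo_triangle doo_tb.
exists M => r r0; have r8 : 0 < r / 8 by rewrite divr_gt0.
have [N hN] := doo_tb r8; have [i hi] := y_net r8.
(* [N] provides a net for the points of [M], and [m i] one for the indices [v] at all late times. *)
pose K := maxn N (m i).
have close : \forall k \near \oo, forall u, (u < K)%N -> forall u', (u' < K)%N ->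
    `|doo u u' - y k u u'| < r / 8.
  apply: near_forall_lt => u uK; apply: near_forall_lt => u' uK'.
  have /cvgrPdist_lt := @y_cvg u u'; exact.
near=> k.
have Kk : (K < k)%N by near: k; exists K.+1.
have mik : (m i <= k)%N by apply: ltnW; apply: leq_ltn_trans Kk; exact: leq_maxr.
have hk : forall v, (v < k)%N -> exists2 u, (u < m i)%N & y k v u < r / 8.
  by near: k.
have ck : forall u, (u < K)%N -> forall u', (u' < K)%N ->
    `|doo u u' - y k u u'| < r / 8 by near: k.
exists (fun v z => (v < k)%N /\ exists u,
  [/\ (u < K)%N, y k v u < r / 8 & mdist z (emb u) < r / 4]); split.
- move=> v vk; have [u um yu] := hk v vk; exists (emb u); split => //; exists u.
  by rewrite mdistxx divr_gt0 // leq_max um orbT.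
- move=> z; have [e ze] := dense z _ r8; have [u uN eu] := hN e.
  have uK : (u < K)%N by rewrite leq_max uN.
  exists u; first exact: ltn_trans uK Kk.
  split; first exact: ltn_trans uK Kk.
  exists u; split => //; first by rewrite /y ddxx mul0r.
  apply: le_lt_trans (metric_triangle z (emb e) (emb u)) _.
  by rewrite embE; lra.
- by move=> v z [].
- move=> v v' z z' [vk [u [uK yu zu]]] [v'k [u' [u'K yu' zu']]].
  have uk := ltn_trans uK Kk; have u'k := ltn_trans u'K Kk.
  have tri e f g : (f < k)%N -> y k e g <= y k e f + y k f g.
    move=> fk; rewrite /y -mulrDl ler_pM2r ?invr_gt0//.
    exact: dd_triangle mik fk.
  have ysym e f : y k e f = y k f e by rewrite /y dd_sym.
  have := ck u uK u' u'K; rewrite -embE -/(y k v v').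
  have := tri v u v' uk; have := tri u u' v' u'k.
  have := tri u v u' vk; have := tri v v' u' v'k.
  have := metric_triangle z (emb u) z'; have := metric_triangle (emb u) (emb u') z'.
  have := metric_triangle (emb u) z (emb u'); have := metric_triangle z z' (emb u').
  rewrite (ysym u v) (ysym u' v') (metric_sym (emb u) z) (metric_sym (emb u') z').
  by rewrite !ler_norml ltr_norml; lra.
Unshelve. all: by end_near. Qed.

End ScalingLimit.

(** * The grafting process *)

(** Plane trees are countably many; the code lets events be cut into countable unions although trees
    carry no sigma-algebra. *)
Definition tree_code (t : plane_tree) : nat :=
  pickle (Tagged (fun k => {perm half_edge k}) (next_half t)).

Lemma tree_code_inj : injective tree_code.
Proof.
move=> [k s sc sa] [k' s' sc' sa'] /(pcan_inj pickleK) /= E.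
have kk' : k = k' by have := congr1 tag E.
subst k'; have ss' : s = s' by move/eqP: E; rewrite eq_Tagged => /eqP.
by subst s'; congr PlaneTree; exact: Prop_irrelevance.
Qed.

Section GraftedProcess.
Variables (R : realType) (d : measure_display) (Omega : measurableType d).
Variables (P : probability Omega R) (S : plane_tree) (T : nat -> Omega -> plane_tree).
Hypothesis hT : preferential_attachment P S T.
Implicit Types (n : nat) (w : Omega).

Let n0 := tree_order S.

(** The past up to time [n] is a countable partition, indexed by this number: its atoms are the
    events [past], and conditioning becomes summation over atoms. *)
Definition history n w : nat := pickle [seq tree_code (T m w) | m <- iota n0 (n.+1 - n0)].

Lemma history_eq n w w' : history n w = history n w' ->
  forall m, (n0 <= m <= n)%N -> T m w = T m w'.
Proof.
move=> /(pcan_inj pickleK) /eq_in_map E m /andP[n0m mn].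
apply/tree_code_inj/E; rewrite mem_iota n0m /=.
by rewrite subnKC ?ltnS// (leq_trans n0m)// ltnW.
Qed.

Lemma history_past n w : [set w' | history n w' = history n w] = past S T (T^~ w) n.
Proof.
apply/seteqP; split=> w' /= E; first exact: history_eq.
congr pickle; apply/eq_in_map => m; rewrite mem_iota => /andP[n0m].
have [n0n|nn0] := leqP n0 n.+1.
  by rewrite subnKC// ltnS => mn; rewrite E// n0m.
by rewrite (_ : (n.+1 - n0)%N = 0%N) ?addn0 ?ltnNge ?n0m//; apply/eqP; rewrite subn_eq0 ltnW.
Qed.

Lemma measurable_past n t : measurable (past S T t n).
Proof.
case: hT => mT _ _.
have [n0n|nn0] := leqP n0 n; last first.
  rewrite (_ : past S T t n = setT); first exact: measurableT.
  by apply/seteqP; split => // w _ m /andP[] /leq_trans h /h; rewrite leqNgt nn0.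
rewrite (_ : past S T t n = \bigcap_(m in [set m | (n0 <= m <= n)%N]) [set w | T m w = t m]).
  apply: bigcap_measurable; first by exists n; rewrite /= n0n leqnn.
  by move=> m /andP[n0m _]; exact: mT.
by apply/seteqP; split=> w h m; exact: h.
Qed.

Lemma measurable_history n (A : set Omega) :
  (forall w w', history n w = history n w' -> A w -> A w') -> measurable A.
Proof.
move=> hA; rewrite (_ : A = \bigcup_i (A `&` [set w | history n w = i])); last first.
  by apply/seteqP; split=> [w Aw|w [i _ []]//]; exists (history n w).
apply: bigcupT_measurable => i.
have [[w [Aw wi]]|/forallNP h] := pselect (exists w, (A `&` [set w | history n w = i]) w).
  rewrite (_ : _ `&` _ = past S T (T^~ w) n); first exact: measurable_past.
  rewrite -history_past; apply/seteqP; split => [w' [_ /= ->]|w' /= E].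
    by rewrite -wi.
  by split; [exact: (hA w)|rewrite /= E].
rewrite (_ : _ `&` _ = set0); first exact: measurable0.
by apply/seteqP; split => // w /h.
Qed.

Lemma measurable_fun_history n (D : set Omega) (f : Omega -> R) :
  (forall w w', history n w = history n w' -> f w = f w') ->
  measurable_fun D (EFin \o f).
Proof.
move=> hf; apply/measurable_funTS => _ Y mY; rewrite setTI.
by apply: (@measurable_history n) => w w' /hf /= ->.
Qed.

Lemma history_mono n n' w w' : (n <= n')%N -> history n' w = history n' w' ->
  history n w = history n w'.
Proof.
move=> nn' E; have h := history_eq E.
have : past S T (T^~ w') n w.
  by move=> m /andP[n0m mn]; apply: h; rewrite n0m (leq_trans mn).
by rewrite -history_past.
Qed.

Lemma history_tree n w w' : (n0 <= n)%N -> history n w = history n w' -> T n w = T n w'.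
Proof. by move=> n0n /history_eq; apply; rewrite n0n leqnn. Qed.

Let integral_history n (f : Omega -> \bar R) : measurable_fun setT f ->
  (forall w, (0 <= f w)%E) ->
  (\int[P]_w f w = \sum_(0 <= i <oo) \int[P]_(w in [set w | history n w = i]) f w)%E.
Proof.
move=> mf f0; have E : [set: Omega] = \bigcup_i [set w | history n w = i].
  by apply/seteqP; split => // w _; exists (history n w).
rewrite E; apply: ge0_integral_bigcup.
- by move=> i; apply: (@measurable_history n) => w w' /= ->.
- by rewrite -E.
- by [].
- by apply/trivIsetP => i j _ _ ij; rewrite -subset0 => w [/= -> /eqP]; rewrite (negPf ij).
Qed.

(** The transition law is known for one target tree at a time, so the atom is cut along the code of
    the next tree. Several corners may give the same tree, hence the regrouping of corners by code
    in [g]. *)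
Let integral_past n (t : nat -> plane_tree) (F : plane_tree -> R) : (n0 <= n)%N ->
  (forall u, 0 <= F u) ->
  (\int[P]_(w in past S T t n) (F (T n.+1 w))%:E =
   (graft_mean F (t n))%:E * P (past S T t n))%E.
Proof.
move=> n0n F0; have mA := measurable_past n t; set A := past S T t n in mA *.
have hq t' : P (A `&` [set w | T n.+1 w = t']) = (P A *
    (#|[set c : corner (t n) | `[< graft c = t' >] ]%SET|%:R / #|corner (t n)|%:R)%:E)%E.
  by case: hT => _ _; exact.
have PA : P A \is a fin_num by exact: fin_num_measure.
pose p := fine (P A); have pE : P A = p%:E by rewrite fineK.
pose B i := A `&` [set w | tree_code (T n.+1 w) = i].
have mC i : measurable [set w | tree_code (T n.+1 w) = i].
  apply: (@measurable_history n.+1) => w w' /(history_tree (leqW n0n)) /= ->.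
  exact.
have AE : A = \bigcup_i B i.
  by apply/seteqP; split=> [w Aw|w [i _ []]//]; exists (tree_code (T n.+1 w)).
pose g i : R := (\sum_(c : corner (t n) | tree_code (graft c) == i) F (graft c))
  / #|corner (t n)|%:R.
have g0 i : 0 <= g i by rewrite divr_ge0// sumr_ge0.
have intB i : (\int[P]_(w in B i) (F (T n.+1 w))%:E = (g i * p)%:E)%E.
  have [[t' t'i]|/forallNP h] := pselect (exists t', tree_code t' = i).
    have BE : B i = A `&` [set w | T n.+1 w = t'].
      rewrite /B; congr (_ `&` _); apply/seteqP; split => w /=; last by move=> ->.
      by rewrite -t'i => /tree_code_inj.
    transitivity (\int[P]_(w in B i) (cst (F t')%:E w))%E.
      by apply: eq_integral => w; rewrite BE inE => -[_ /= ->].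
    rewrite integral_cst; last exact: measurableI.
    transitivity ((F t')%:E * P (A `&` [set w | T n.+1 w = t']))%E; first by rewrite BE.
    rewrite hq pE -!EFinM; congr _%:E; rewrite mulrCA mulrC; congr (_ * _).
    rewrite /g mulrA; congr (_ / _).
    rewrite (eq_bigr (fun=> F t')); last first.
      by move=> c; rewrite -t'i => /eqP /tree_code_inj ->.
    rewrite sumr_const mulr_natr; congr (_ *+ _); rewrite cardsE; apply: eq_card => c.
    rewrite /in_mem /= -t'i eqnE; apply/asboolP/eqP => [->//|]; exact: tree_code_inj.
  have -> : B i = set0.
    by apply/seteqP; split => // w [_ /= wi]; apply: (h (T n.+1 w)).
  rewrite integral_set0 /g big_pred0 ?mul0r// => c.
  by apply/negP => /eqP cE; exact: h cE.
have FE w : (0 <= (F (T n.+1 w))%:E)%E by rewrite lee_fin.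
rewrite AE ge0_integral_bigcup//; last 3 first.
- by move=> i; exact: measurableI.
- apply: measurable_fun_history => w w' /(history_tree (leqW n0n)) ->.
  by [].
- by apply/trivIsetP => i j _ _ ij; rewrite -subset0
    => w [[_ /= wi] [_ /= wj]]; move: ij; rewrite -wi -wj eqxx.
under eq_eseriesr do rewrite intB.
rewrite -AE pE.
(* Finitely many grafts are possible, so the series over codes stops at [M]. *)
pose M := (\max_(c : corner (t n)) tree_code (graft c)).+1.
have gM i : (M <= i)%N -> g i = 0.
  move=> Mi; rewrite /g big_pred0 ?mul0r// => c; apply/negP => /eqP ci.
  have := @leq_bigmax _ (fun c : corner (t n) => tree_code (graft c)) c.
  by rewrite ci -ltnS -/M leqNgt ltnS Mi.
rewrite (nneseries_split 0 M); last first.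
  by move=> i _; rewrite lee_fin mulr_ge0// fine_ge0.
rewrite add0n eseries0 ?adde0; last first.
  by move=> i Mi _; rewrite gM// mul0r.
rewrite sumEFin -EFinM; congr _%:E; rewrite -mulr_suml; congr (_ * _).
rewrite /g -mulr_suml /graft_mean; congr (_ / _).
rewrite big_mkord (exchange_big_dep predT) //=; apply: eq_bigr => c _.
have cM : (tree_code (graft c) < M)%N.
  by rewrite ltnS (@leq_bigmax _ (fun c : corner (t n) => tree_code (graft c))).
by rewrite (big_pred1 (Ordinal cM)).
Qed.

(** The Markov property in integrated form. [F] may depend on the past, being constant on each atom;
    this is needed to freeze a distance at an earlier time. *)
Lemma integral_graft n (F : Omega -> plane_tree -> R) : (n0 <= n)%N ->
  (forall w t, 0 <= F w t) ->
  (forall w w', history n w = history n w' -> F w = F w') ->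
  (\int[P]_w (F w (T n.+1 w))%:E = \int[P]_w (graft_mean (F w) (T n w))%:E)%E.
Proof.
move=> n0n F0 hF.
have mean0 w : 0 <= graft_mean (F w) (T n w) by rewrite divr_ge0// sumr_ge0.
rewrite (integral_history n); last 2 first.
- apply: (@measurable_fun_history n.+1) => w w' E.
  by rewrite (hF _ _ (history_mono (leqnSn n) E)) (history_tree (leqW n0n) E).
- by move=> w; rewrite lee_fin.
rewrite (integral_history n); last 2 first.
- by apply: (@measurable_fun_history n) => w w' E; rewrite (hF _ _ E) (history_tree n0n E).
- by move=> w; rewrite lee_fin.
apply: eq_eseriesr => i _.
have [[w0 w0i]|/forallNP h] := pselect (exists w, history n w = i); last first.
  have -> : [set w | history n w = i] = set0 by apply/seteqP; split => // w /h.
  by rewrite !integral_set0.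
rewrite -w0i history_past.
have inpast w : w \in past S T (T^~ w0) n -> history n w = history n w0.
  by rewrite inE -history_past.
transitivity (\int[P]_(w in past S T (T^~ w0) n) (F w0 (T n.+1 w))%:E)%E.
  by apply: eq_integral => w /inpast /hF ->.
rewrite integral_past//.
transitivity (\int[P]_(w in past S T (T^~ w0) n)
    (cst (graft_mean (F w0) (T n w0))%:E w))%E; last first.
  by apply: eq_integral => w /inpast E; rewrite (hF _ _ E) (history_tree n0n E).
by rewrite integral_cst//; exact: measurable_past.
Qed.

Definition grafted w : Prop := T n0 w = S /\
  forall n, (n0 <= n)%N -> exists c : corner (T n w), T n.+1 w = graft c.

(** The indicator that the next tree is not a graft of the current one has transition mean 0. *)
Lemma ae_grafted : {ae P, forall w, grafted w}.
Proof.
have [mT PS _] := hT.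
have h0 : {ae P, forall w, T n0 w = S}.
  exists (~` [set w | T n0 w = S]); split.
  - exact: measurableC (mT _ _ (leqnn _)).
  - have /= := probability_setC P (mT _ S (leqnn n0)).
    by rewrite PS subee// => ->.
  - by move=> w.
have h1 : {ae P, forall w, forall n, (n0 <= n)%N -> exists c : corner (T n w), T n.+1 w = graft c}.
  apply/ae_foralln => n.
  have [n0n|nn0] := leqP n0 n; last by apply: aeW => w.
  pose N := [set w | ~ exists c : corner (T n w), T n.+1 w = graft c].
  have mN : measurable N.
    apply: (@measurable_history n.+1) => w w' E; rewrite /N /= (history_tree (leqW n0n) E).
    have -> // : T n w = T n w' by apply: history_tree (history_mono (leqnSn n) E).
  exists N; split => //; last first.
    by move=> w /= nh [c hc]; apply: nh => _; exists c.
  pose F w t : R := (`[< ~ exists c : corner (T n w), t = graft c >])%:R.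
  have F0 w t : 0 <= F w t by [].
  have hF w w' : history n w = history n w' -> F w = F w'.
    by move=> E; apply/funext => t; rewrite /F (history_tree n0n E).
  have := integral_graft n0n F0 hF.
  have -> : (\int[P]_w (F w (T n.+1 w))%:E = P N)%E.
    rewrite -[N]setIT -integral_indic//; apply: eq_integral => w _.
  move=> E; apply: etrans E _; apply: integral0_eq => w _; rewrite /graft_mean big1 ?mul0r// => c _.
  by rewrite /F; case: asboolP => // h; exfalso; apply: h; exists c.
apply: filterS2 h0 h1 => w; by split.
Qed.

End GraftedProcess.

(** * Moment bounds along the process, where [T k.+1] has [k] edges *)

Section GrowthEstimates.
Variables (R : realType) (d : measure_display) (Omega : measurableType d).
Variables (P : probability Omega R) (S : plane_tree) (T : nat -> Omega -> plane_tree).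
Hypothesis hT : preferential_attachment P S T.
Implicit Types (k m n : nat) (w : Omega).

Lemma tree_orderE (t : plane_tree) : tree_order t = (nedges t).+1.
Proof. exact: plane_tree_acyclic. Qed.

Lemma grafted_nedges w k : grafted S T w -> (nedges S <= k)%N -> nedges (T k.+1 w) = k.
Proof.
rewrite /grafted tree_orderE => -[TS Tg]; elim: k => [|k IH].
  rewrite leqn0 => /eqP S0; have := nedges_gt0 S; by rewrite S0.
rewrite leq_eqVlt => /predU1P[<-|Sk]; first by rewrite TS.
by have [c ->] := Tg k.+1 Sk; rewrite /= IH.
Qed.

Let tau k w := T k.+1 w.
Let hist k w := history S T k.+1 w.

Let tau_hist k w w' : (nedges S <= k)%N -> hist k w = hist k w' -> tau k w = tau k w'.
Proof. by move=> Sk; apply: history_tree; rewrite tree_orderE. Qed.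

Lemma measurable_fun_tree k (D : set Omega) (F : plane_tree -> R) :
  (nedges S <= k)%N -> measurable_fun D (fun w => (F (T k.+1 w))%:E).
Proof.
move=> Sk; apply: (measurable_fun_history hT (n := k.+1)) => w w' E.
by rewrite -/(tau k w) (tau_hist Sk E).
Qed.

(* In [F i w t] the argument [w] only carries the past up to the initial time [k]. *)
Lemma integral_superharmonic k k' (F : nat -> Omega -> plane_tree -> R) :
  (nedges S <= k <= k')%N -> (forall i w t, (k <= i)%N -> 0 <= F i w t) ->
  (forall i w w', history S T k.+1 w = history S T k.+1 w' -> F i w = F i w') ->
  (forall w t, (k <= nedges t)%N ->
    graft_mean (F (nedges t).+1 w) t <= F (nedges t) w t) ->
  (\int[P]_w (F k' w (T k'.+1 w))%:E <= \int[P]_w (F k w (T k.+1 w))%:E)%E.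
Proof.
move=> /andP[Sk kk'] F0 hF super; rewrite -(subnKC kk'); move: (k' - k)%N => l.
elim: l => [|l IH]; first by rewrite addn0.
apply: le_trans IH; rewrite addnS; set i := (k + l)%N.
have ki : (k <= i)%N by rewrite leq_addr.
have Si : (nedges S <= i)%N by exact: leq_trans ki.
have hFi j w w' : history S T i.+1 w = history S T i.+1 w' -> F j w = F j w'.
  by move=> E; apply: hF; apply: history_mono E; rewrite ltnS.
pose G w t := Num.max 0 (F i.+1 w t).
have GE w t : G w t = F i.+1 w t by apply/max_idPr; rewrite F0// leqW.
have := @integral_graft _ _ _ _ _ _ hT i.+1 (F i.+1); rewrite tree_orderE => ->//; last 2 first.
- by move=> w t; rewrite F0 // leqW.
- exact: hFi.
have mean0 w t : 0 <= graft_mean (F i.+1 w) t.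
  by rewrite divr_ge0// sumr_ge0// => c _; rewrite F0// leqW.
apply: ae_ge0_le_integral => //.
- by move=> w _; rewrite lee_fin.
- apply: (measurable_fun_history hT (n := i.+1)) => w w' E.
  by rewrite (hFi _ _ _ E) -/(tau i w) (tau_hist Si E).
- by move=> w _; rewrite lee_fin F0.
- apply: (measurable_fun_history hT (n := i.+1)) => w w' E.
  by rewrite (hFi _ _ _ E) -/(tau i w) (tau_hist Si E).
apply: filterS (ae_grafted hT) => w gw _; rewrite lee_fin.
have Ei := grafted_nedges gw Si; have := super w (T i.+1 w).
by rewrite Ei => /(_ ki).
Qed.

Let ae_nedges k : (nedges S <= k)%N -> {ae P, forall w, nedges (T k.+1 w) = k}.
Proof. by move=> Sk; apply: filterS (ae_grafted hT) => w gw; exact: grafted_nedges. Qed.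

Lemma integral_le_cst k (F : plane_tree -> R) (c : R) : (nedges S <= k)%N ->
  0 <= c -> (forall t, 0 <= F t) -> (forall t, nedges t = k -> F t <= c) ->
  (\int[P]_w (F (T k.+1 w))%:E <= c%:E)%E.
Proof.
move=> Sk c0 F0 Fc.
apply: le_trans (_ : \int[P]_w (cst c%:E w) <= _)%E; last first.
  rewrite integral_cst//; rewrite -[leRHS]mule1; apply: lee_wpmul2l => //.
  exact: probability_le1.
apply: ae_ge0_le_integral => //.
- by move=> w _; rewrite lee_fin.
- exact: measurable_fun_tree.
- apply: filterS (ae_nedges Sk) => w E _; rewrite lee_fin; exact: Fc.
Qed.

(** The ratio of consecutive weights is (k + 4)/k = 1 + 4/k, exactly the growth factor of
    [graft_mean_height_gen]. *)
Definition height_weight k : R := k%:R * (k%:R + 1) * (k%:R + 2) * (k%:R + 3).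

Lemma integral_height_gen m k : (nedges S <= m)%N -> (m <= k)%N ->
  (\int[P]_w (height_gen R m k (T k.+1 w))%:E <= (height_weight k)%:E)%E.
Proof.
move=> Sm mk; have m0 : (0 < m)%N := leq_trans (nedges_gt0 S) Sm.
have wt0 i : (0 < i)%N -> 0 < height_weight i.
  by move=> i0; rewrite !mulr_gt0// ?ltr0n// addr_gt0 ?ltr0n.
pose F i (w : Omega) t := height_gen R m i t / height_weight i.
have F0 i w t : (m <= i)%N -> 0 <= F i w t.
  by move=> mi; rewrite divr_ge0 ?height_gen_ge0// ltW// wt0// (leq_trans m0).
have := @integral_superharmonic m k F.
rewrite Sm mk => /(_ isT F0 (fun _ _ _ _ => erefl)) h.
have {}h := h _; have {h} : (\int[P]_w (F k w (T k.+1 w))%:E <=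
    \int[P]_w (F m w (T m.+1 w))%:E)%E.
  apply: h => w t mt; rewrite /F; have t0 := nedges_gt0 t.
  have -> : graft_mean (fun t' => height_gen R m (nedges t).+1 t' / height_weight (nedges t).+1) t =
      graft_mean (height_gen R m (nedges t).+1) t / height_weight (nedges t).+1.
    by rewrite /graft_mean -mulr_suml mulrAC.
  apply: le_trans (_ : (1 + 4 / (nedges t)%:R) * height_gen R m (nedges t) t /
    height_weight (nedges t).+1 <= _).
    by rewrite ler_pM2r ?invr_gt0 ?wt0//; exact: graft_mean_height_gen.
  rewrite mulrAC [leRHS]mulrC; apply: ler_wpM2r; first exact: height_gen_ge0.
  rewrite /height_weight -[(nedges t).+1%:R]natr1; have : 0 < (nedges t)%:R :> R by rewrite ltr0n.
  move: (nedges t)%:R => x x0; rewrite le_eqVlt; apply/orP; left; apply/eqP.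
  by field; rewrite !gt_eqF//; lra.
move=> /le_trans h; have {}h : (\int[P]_w (F k w (T k.+1 w))%:E <= 1%:E)%E.
  apply: h; apply: (@integral_le_cst m (fun t => height_gen R m m t / height_weight m)) => //.
    by move=> t; rewrite divr_ge0 ?height_gen_ge0// ltW// wt0.
  move=> t tm; rewrite ler_pdivrMr ?wt0// mul1r /height_gen.
  under eq_bigr => v _ do rewrite dist_to_self// expr0.
  rewrite sumr_const card_ord -[_ *+ m]/(m%:R) /height_weight.
  have : 1 <= m%:R :> R by rewrite ler1n.
  move: (m%:R : R) => x x1; rewrite -!mulrA ler_pMr; last by lra.
  by nra.
have k0 : (0 < k)%N := leq_trans m0 mk.
have -> : (\int[P]_w (height_gen R m k (T k.+1 w))%:E =
    (height_weight k)%:E * \int[P]_w (F k w (T k.+1 w))%:E)%E.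
  rewrite -ge0_integralZl_EFin//; last 3 first.
  - by move=> w _; rewrite lee_fin F0.
  - apply: measurable_fun_tree; exact: leq_trans mk.
  - exact/ltW/wt0.
  apply: eq_integral => w _; rewrite -EFinM; congr _%:E.
  by rewrite /F mulrC divfK// gt_eqF// wt0.
rewrite -[leRHS]mule1; apply: lee_wpmul2l => //.
by rewrite lee_fin ltW// wt0.
Qed.

Definition increment_excess e f k k' t t' : R :=
  Num.max ((loop_dist t' e f)%:R / loop_scale R k' -
           (loop_dist t e f)%:R / loop_scale R k) 0 ^+ 2.

Let sqr_excess0 k m : (0 < m)%N -> (k <= m)%N -> sqr_excess 0 (loop_scale R m) k%:R <= 4 * m%:R.
Proof.
move=> m0 km; rewrite /sqr_excess subr0; have s0 := loop_scale_gt0 R m0.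
rewrite (max_idPl _); last by rewrite divr_ge0// ltW.
have x1 : 1 <= m%:R :> R by rewrite ler1n.
have y0 : 0 <= k%:R :> R by [].
have yx : k%:R <= m%:R :> R by rewrite ler_nat.
rewrite expr_div_n -mulrDl loop_scale_sqr// ler_pdivrMr; last by lra.
by nra.
Qed.

(** At time [k] the level in [excess] is the current rescaled distance X, so the squared part
    vanishes and X / [loop_scale R k] remains. Then X <= 1 + X^2, and X^2 is controlled in mean by
    the same supermartingale with level 0 started at time [m], where it is at most 4 m. *)
Lemma integral_increment_excess e f m k k' : (nedges S <= m)%N -> (m <= k)%N ->
  (k <= k')%N -> (e < m)%N -> (f < m)%N ->
  (\int[P]_w (increment_excess e f k k' (T k.+1 w) (T k'.+1 w))%:E <=
     (5 * m%:R / loop_scale R k)%:E)%E.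
Proof.
move=> Sm mk kk' em fm; have m0 : (0 < m)%N := leq_trans (nedges_gt0 S) Sm.
have k0 : (0 < k)%N := leq_trans m0 mk.
have Sk : (nedges S <= k)%N := leq_trans Sm mk.
have Sk' : (nedges S <= k')%N := leq_trans Sk kk'.
have sk0 := loop_scale_gt0 R k0.
pose X w := (loop_dist (T k.+1 w) e f)%:R / loop_scale R k.
have X0 w : 0 <= X w by rewrite divr_ge0// ltW.
have XE w w' : hist k w = hist k w' -> X w = X w'.
  by move=> E; rewrite /X -/(tau k w) (tau_hist Sk E).
have super x w t j : (m <= j)%N -> (j <= nedges t)%N ->
    graft_mean (excess e f x (nedges t).+1) t <= excess e f x (nedges t) t :> R.
  by move=> mj jt; apply: graft_mean_excess; apply: leq_trans (leq_trans mj jt).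
pose F i w t := excess e f (X w) i t.
have step1 : (\int[P]_w (F k' w (T k'.+1 w))%:E <= \int[P]_w (F k w (T k.+1 w))%:E)%E.
  apply: integral_superharmonic; rewrite ?Sk ?kk'//.
  - by move=> i w t _; exact: excess_ge0.
  - by move=> i w w' E; rewrite /F (XE _ _ E).
  - by move=> w t kt; exact: (super _ w) mk kt.
pose G i (w : Omega) t : R := excess e f 0 i t.
have step2 : (\int[P]_w (G k w (T k.+1 w))%:E <= (4 * m%:R)%:E)%E.
  apply: le_trans (_ : \int[P]_w (G m w (T m.+1 w))%:E <= _)%E.
    apply: integral_superharmonic; rewrite ?Sm ?mk//.
    - by move=> i w t _; exact: excess_ge0.
    - by move=> w t mt; exact: (super _ w) (leqnn m) mt.
  apply: (@integral_le_cst m (excess e f 0 m)) => //.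
  - by move=> t; exact: excess_ge0.
  - by move=> t tm; apply: sqr_excess0 => //; rewrite -tm loop_dist_le_nedges.
apply: le_trans (le_trans _ step1) _.
  apply: ge0_le_integral => //.
  - by move=> w _; rewrite lee_fin sqr_ge0.
  - apply: (measurable_fun_history hT (n := k'.+1)) => w w' E.
    rewrite -/(tau k w) -/(tau k' w) (tau_hist Sk' E).
    by rewrite (tau_hist Sk (history_mono _ E))// ltnS.
  - apply: (measurable_fun_history hT (n := k'.+1)) => w w' E.
    rewrite /F (XE w w') -/(tau k' w) ?(tau_hist Sk' E)//.
    by apply: history_mono E; rewrite ltnS.
  - by move=> w _; rewrite lee_fin lerDl divr_ge0 ?sqr_ge0.
have FG w : F k w (T k.+1 w) <= (loop_scale R k)^-1 * (1 + G k w (T k.+1 w)).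
  rewrite /F /G /excess /sqr_excess -/(X w) subrr subr0 maxxx expr0n add0r.
  rewrite (max_idPl (X0 w)); set y := _ / _ ^+ 2.
  have y0 : 0 <= y by rewrite divr_ge0 ?sqr_ge0.
  have -> : y = (loop_scale R k)^-1 * X w.
    by rewrite /y /X; field; rewrite gt_eqF.
  have z0 : 0 <= (loop_scale R k)^-1 * X w by rewrite mulr_ge0 ?invr_ge0 ?(ltW sk0).
  rewrite ler_pM2l ?invr_gt0//; move: z0 (X0 w) (sqr_ge0 (X w - 1)).
  by move: (X w) (_ * _) => x z; nra.
apply: le_trans (_ : \int[P]_w ((loop_scale R k)^-1%:E * (1 + (G k w (T k.+1 w))%:E)) <= _)%E.
  apply: ge0_le_integral => //.
  - by move=> w _; rewrite lee_fin excess_ge0.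
  - apply: (measurable_fun_history hT (n := k.+1)) => w w' E.
    by rewrite /F (XE w w' E) -/(tau k w) (tau_hist Sk E).
  - apply: (measurable_fun_history hT (n := k.+1) (f := fun w => (loop_scale R k)^-1 * (1 + G k w (T k.+1 w)))) => w w' E.
    by rewrite /G -/(tau k w) (tau_hist Sk E).
  - by move=> w _; rewrite -EFinD -EFinM lee_fin.
have mG : measurable_fun setT (fun w => (G k w (T k.+1 w))%:E).
  exact: (@measurable_fun_tree k setT (excess e f 0 k) Sk).
rewrite ge0_integralZl_EFin//; last 3 first.
- by move=> w _; rewrite -EFinD lee_fin addr_ge0// excess_ge0.
- exact: emeasurable_funD.
- by rewrite invr_ge0 ltW.
rewrite [leRHS](_ : _ = (loop_scale R k)^-1%:E * (5 * m%:R)%:E)%E; last first.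
  by rewrite -EFinM mulrC.
apply: lee_wpmul2l; first by rewrite lee_fin invr_ge0 ltW.
rewrite ge0_integralD//; last by move=> w _; rewrite lee_fin excess_ge0.
rewrite integral_cst// mul1e.
apply: le_trans (leeD (probability_le1 P measurableT) step2) _.
rewrite -EFinD lee_fin; have : 1 <= m%:R :> R by rewrite ler1n.
by lra.
Qed.

End GrowthEstimates.

(** * Summable errors *)

Section ErrorProcess.
Variables (R : realType) (d : measure_display) (Omega : measurableType d).
Variables (P : probability Omega R) (S : plane_tree) (T : nat -> Omega -> plane_tree).
Hypothesis hT : preferential_attachment P S T.
Implicit Types (w : Omega).

Section OneStep.
Variables (m k k' : nat) (eps L : R).
Hypothesis Sm : (nedges S <= m)%N.
Hypothesis mk : (m <= k)%N.
Hypothesis kk' : (k <= k')%N.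
Hypothesis eps0 : 0 < eps.
Hypothesis L0 : 0 <= L.

Let m0 : (0 < m)%N := leq_trans (nedges_gt0 S) Sm.

(** By a <= eps + a^2 / eps, second moments bound the increments linearly; the sum over pairs gives
    one error valid for the whole core. *)
Definition core_error w : R := \sum_(p : 'I_m * 'I_m)
  (eps + eps^-1 * increment_excess R p.1 p.2 k k' (T k.+1 w) (T k'.+1 w)).

Definition net_error w : R :=
  4 / loop_scale R m * (L + expR (- L) * height_gen R m k' (T k'.+1 w)).

Let incr_term_ge0 e f w :
  0 <= eps + eps^-1 * increment_excess R e f k k' (T k.+1 w) (T k'.+1 w).
Proof.
apply: addr_ge0; first exact: ltW.
by apply: mulr_ge0; [rewrite invr_ge0 ltW|exact: sqr_ge0].
Qed.

Lemma core_error_ge0 w : 0 <= core_error w.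
Proof. by apply: sumr_ge0 => p _. Qed.

Lemma net_error_ge0 w : 0 <= net_error w.
Proof.
rewrite mulr_ge0 ?divr_ge0 ?(ltW (loop_scale_gt0 R m0))//.
rewrite addr_ge0// mulr_ge0 ?expR_ge0//; apply: height_gen_ge0 => //.
exact: leq_trans kk'.
Qed.

Lemma core_error_incr e f w : (e < m)%N -> (f < m)%N ->
  (loop_dist (T k'.+1 w) e f)%:R / loop_scale R k' <=
  (loop_dist (T k.+1 w) e f)%:R / loop_scale R k + core_error w.
Proof.
move=> em fm; rewrite /core_error (bigD1 (Ordinal em, Ordinal fm)) //=.
rewrite addrA -[leLHS]addr0; apply: lerD; last exact: sumr_ge0.
rewrite /increment_excess; set y' := _ / _; set y := _ / _.
rewrite -lerBlDl; set z := y' - y.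
apply: le_trans (_ : Num.max z 0 <= _); first by rewrite le_max lexx.
have : 0 <= Num.max z 0 by rewrite le_max lexx orbT.
move: (Num.max z 0) => a a0.
have ei : eps * eps^-1 = 1 by rewrite divff ?gt_eqF.
rewrite -(ler_pM2l eps0) mulrDr [eps * (_ * _)]mulrA ei mul1r.
by have := sqr_ge0 (a - eps); nra.
Qed.

Lemma net_error_net v w : (nedges (T k'.+1 w) = k') -> (v < k')%N ->
  exists2 u, (u < m)%N & (loop_dist (T k'.+1 w) v u)%:R / loop_scale R k' <= net_error w.
Proof.
move=> Tk vk; have [u um E] := dist_to_ex (T k'.+1 w) v m0.
exists u => //; rewrite -E; apply: dist_to_height_gen => //; exact: leq_trans kk'.
Qed.

Lemma measurable_core_error : measurable_fun setT (EFin \o core_error).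
Proof.
have Sk : (nedges S <= k)%N := leq_trans Sm mk.
apply: (measurable_fun_history hT (n := k'.+1)) => w w' E.
have Ek : T k'.+1 w = T k'.+1 w'.
  by apply: history_tree E; rewrite tree_orderE ltnS (leq_trans Sk).
have Ek' : T k.+1 w = T k.+1 w'.
  by apply: history_tree (history_mono _ E); rewrite ?tree_orderE ?ltnS.
by rewrite /core_error Ek Ek'.
Qed.

Lemma measurable_net_error : measurable_fun setT (EFin \o net_error).
Proof.
have Sk' : (nedges S <= k')%N := leq_trans (leq_trans Sm mk) kk'.
exact: (@measurable_fun_tree _ _ _ _ _ _ hT k' setT
  (fun t => 4 / loop_scale R m * (L + expR (- L) * height_gen R m k' t)) Sk').
Qed.

Lemma integral_core_error : (\int[P]_w (core_error w)%:E <=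
  (m%:R ^+ 2 * (eps + eps^-1 * (5 * m%:R / loop_scale R k)))%:E)%E.
Proof.
have Sk : (nedges S <= k)%N := leq_trans Sm mk.
have Sk' : (nedges S <= k')%N := leq_trans Sk kk'.
have mI e f : measurable_fun setT (fun w =>
    (increment_excess R e f k k' (T k.+1 w) (T k'.+1 w))%:E).
  apply: (measurable_fun_history hT (n := k'.+1)) => w w' E.
  have Ek : T k'.+1 w = T k'.+1 w'.
    by apply: history_tree E; rewrite tree_orderE ltnS.
  have Ek' : T k.+1 w = T k.+1 w'.
    by apply: history_tree (history_mono _ E); rewrite ?tree_orderE ?ltnS.
  by rewrite Ek Ek'.
pose g (p : 'I_m * 'I_m) w : \bar R := (eps%:E +
  eps^-1%:E * (increment_excess R p.1 p.2 k k' (T k.+1 w) (T k'.+1 w))%:E)%E.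
have -> : (\int[P]_w (core_error w)%:E = \int[P]_w (\sum_(p : 'I_m * 'I_m) g p w))%E.
  by apply: eq_integral => w _; rewrite /core_error -sumEFin.
have g0 p w : (0 <= g p w)%E by rewrite /g -EFinM -EFinD lee_fin.
have mg p : measurable_fun setT (g p).
  by apply: emeasurable_funD => //; exact: measurable_funeM.
rewrite ge0_integral_sum//.
rewrite [leRHS](_ : _ = \sum_(p : 'I_m * 'I_m)
    (eps + eps^-1 * (5 * m%:R / loop_scale R k))%:E)%E; last first.
  rewrite sumEFin sumr_const card_prod !card_ord; congr _%:E.
  by rewrite -[RHS]mulr_natl natrM expr2.
apply: lee_sum => p _; rewrite /g ge0_integralD//; last 3 first.
- by move=> w _; rewrite lee_fin ltW.
- by move=> w _; rewrite -EFinM lee_fin mulr_ge0 ?invr_ge0 ?(ltW eps0)// sqr_ge0.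
- exact: measurable_funeM.
rewrite ge0_integralZl_EFin//; last 2 first.
- by move=> w _; rewrite lee_fin sqr_ge0.
- by rewrite invr_ge0 ltW.
rewrite EFinD EFinM; apply: leeD.
  rewrite integral_cst// -[leRHS]mule1; apply: lee_wpmul2l; first by rewrite lee_fin ltW.
  exact: probability_le1.
apply: lee_wpmul2l; first by rewrite lee_fin invr_ge0 ltW.
exact (integral_increment_excess hT Sm mk kk' (ltn_ord p.1) (ltn_ord p.2)).
Qed.

Lemma integral_net_error : (\int[P]_w (net_error w)%:E <=
  (4 / loop_scale R m * (L + expR (- L) * height_weight R k'))%:E)%E.
Proof.
have Sk' : (nedges S <= k')%N := leq_trans (leq_trans Sm mk) kk'.
have mk' : (m <= k')%N := leq_trans mk kk'.
have h0 w : 0 <= height_gen R m k' (T k'.+1 w) by exact: height_gen_ge0.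
have mH : measurable_fun setT (fun w => (height_gen R m k' (T k'.+1 w))%:E).
  exact: (@measurable_fun_tree _ _ _ _ _ _ hT k' setT (height_gen R m k') Sk').
have c0 : 0 <= 4 / loop_scale R m by rewrite divr_ge0 ?(ltW (loop_scale_gt0 R m0)).
have -> : (\int[P]_w (net_error w)%:E = \int[P]_w ((4 / loop_scale R m)%:E *
    (L%:E + (expR (- L))%:E * (height_gen R m k' (T k'.+1 w))%:E)))%E by [].
have mE : measurable_fun setT (fun w =>
    ((expR (- L))%:E * (height_gen R m k' (T k'.+1 w))%:E)%E) by exact: measurable_funeM.
rewrite ge0_integralZl_EFin//; last 2 first.
- by move=> w _; rewrite -EFinM -EFinD lee_fin addr_ge0 ?mulr_ge0 ?expR_ge0.
- by apply: emeasurable_funD.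
rewrite [leRHS]EFinM; apply: lee_wpmul2l; first by rewrite lee_fin.
rewrite ge0_integralD//; last by move=> w _; rewrite -EFinM lee_fin mulr_ge0 ?expR_ge0.
rewrite [leRHS]EFinD; apply: leeD.
  rewrite integral_cst// -[leRHS]mule1; apply: lee_wpmul2l; first by rewrite lee_fin.
  exact: probability_le1.
rewrite ge0_integralZl_EFin// ?expR_ge0//; last by move=> w _; rewrite lee_fin.
rewrite [leRHS]EFinM; apply: lee_wpmul2l; first by rewrite lee_fin expR_ge0.
exact (integral_height_gen hT Sm mk').
Qed.

End OneStep.

Lemma loop_scale_ge (x : R) k : (0 < k)%N -> 0 <= x -> x ^+ 2 = k%:R ->
  x / 2 <= loop_scale R k.
Proof.
move=> k0 x0 xk; rewrite -(@ler_pXn2r _ 2)// ?nnegrE ?divr_ge0 ?(ltW (loop_scale_gt0 R k0))//.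
rewrite loop_scale_sqr// expr_div_n xk; have : 1 <= k%:R :> R by rewrite ler1n.
by lra.
Qed.

(* The exponents make the j-th error summable: with n vertices in the core, n^16
   edges in the tree and n = (scale_index j) ^ 6, the increments of the n^2
   distances are of order n^(-16/4) and the distances to the core of order
   n^(-1/2), up to logarithms. *)
Definition scale_index j := (nedges S + j).+1.
Definition core_size j := (scale_index j ^ 6)%N.
Definition level j := (scale_index j ^ 96)%N.

(** Let x be [scale_index j]. With [eps] = x^(-14), the x^12 pairs of the core contribute x^(-2)
    through [eps]; and [L] = 396 x is large enough for [expR (- L)] to cancel [height_weight] at the
    next level. *)
Definition loop_error j w : R :=
  core_error (core_size j) (level j) (level j.+1) ((scale_index j)%:R ^+ 14)^-1 w +
  net_error (core_size j) (level j.+1) (396 * (scale_index j)%:R) w.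

Lemma scale_indexS j : scale_index j.+1 = (scale_index j).+1.
Proof. by rewrite /scale_index addnS. Qed.

Lemma core_size_ge j : (nedges S <= core_size j)%N.
Proof.
apply: leq_trans (leq_pexp2l _ (isT : 1 <= 6)%N) => //.
by rewrite expn1 /scale_index -addnS leq_addr.
Qed.

Lemma core_size_le_level j : (core_size j <= level j)%N.
Proof. exact: leq_pexp2l. Qed.

Lemma level_homo j : (level j <= level j.+1)%N.
Proof. by rewrite /level leq_exp2r// scale_indexS. Qed.

(** The constant is 396 = 4 (3 + 96): the weight at y = (x + 1)^96 is at most (4 y)^4, with 4 <=
    exp(3 x) and y <= exp(96 x). *)
Let expR_weight (x : R) : 1 <= x ->
  expR (- (396 * x)) * ((x + 1) ^+ 96 * ((x + 1) ^+ 96 + 1) *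
    ((x + 1) ^+ 96 + 2) * ((x + 1) ^+ 96 + 3)) <= 1.
Proof.
move=> x1; rewrite expRN ler_pdivrMl ?expR_gt0// mulr1.
have -> : 396 * x = 4%:R * (3 * x + 96%:R * x) by ring.
rewrite expRM_natl expRD [expR (96%:R * x)]expRM_natl.
have e1 : 4 <= expR (3 * x) by apply: le_trans (expR_ge1Dx _); lra.
have y1 : 1 <= (x + 1) ^+ 96 by rewrite exprn_ege1//; lra.
have e2 : (x + 1) ^+ 96 <= expR x ^+ 96.
  by rewrite lerXn2r ?nnegrE ?expR_ge0//; [lra|rewrite addrC; exact: expR_ge1Dx].
move: ((x + 1) ^+ 96) (expR x ^+ 96) (expR (3 * x)) y1 e1 e2 => y z u y1 u4 yz.
have yzu : 4 * y <= u * z by nra.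
have y4 : 0 <= 4 * y by lra.
apply: le_trans (_ : (4 * y) ^+ 4 <= _); last first.
  by rewrite lerXn2r ?nnegrE ?(le_trans y4 yzu).
have -> : (4 * y) ^+ 4 = y * (4 * y) * (8 * y) * (8 * y) by ring.
have p1 : 0 <= y * (y + 1) by rewrite mulr_ge0//; lra.
have p2 : 0 <= y * (y + 1) * (y + 2) by rewrite mulr_ge0//; lra.
by do 3 ?[apply: ler_pM => //; try lra].
Qed.

(** The three terms are of order x^(12-14), x^(12+14+6-48) and x^(1-3), so the second is negligible.
    The constants found are 1, 10 and 4 * 794, with sum 3187. *)
Let rate (x sm sk : R) : 1 <= x -> x ^+ 3 / 2 <= sm -> x ^+ 48 / 2 <= sk ->
  (x ^+ 6) ^+ 2 * ((x ^+ 14)^-1 + ((x ^+ 14)^-1)^-1 * (5 * x ^+ 6 / sk)) +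
  4 / sm * (396 * x + 1) <= 3200 / x ^+ 2.
Proof.
move=> x1 sm3 sk48; have x0 : 0 < x by lra.
have ix : x^-1 <= 1 by rewrite invf_le1.
have ix0 : 0 < x^-1 by rewrite invr_gt0.
have xn n : 0 < x ^+ n by rewrite exprn_gt0.
have xx : x * x^-1 = 1 by rewrite divff ?gt_eqF.
have ixn n : x ^+ n * x^-1 ^+ n = 1 by rewrite -exprMn xx expr1n.
have sk0 : 0 < sk by apply: lt_le_trans sk48; rewrite divr_gt0.
have sm0 : 0 < sm by apply: lt_le_trans sm3; rewrite divr_gt0.
have hk : sk^-1 <= 2 * x^-1 ^+ 48.
  rewrite -(ler_pM2l sk0) divff ?gt_eqF//; have := ixn 48%N.
  have : 0 < x^-1 ^+ 48 by rewrite exprn_gt0.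
  move: (x ^+ 48) (x^-1 ^+ 48) sk48 => a b; nra.
have hm : sm^-1 <= 2 * x^-1 ^+ 3.
  rewrite -(ler_pM2l sm0) divff ?gt_eqF//; have := ixn 3%N.
  have : 0 < x^-1 ^+ 3 by rewrite exprn_gt0.
  move: (x ^+ 3) (x^-1 ^+ 3) sm3 => a b; nra.
rewrite invrK -!exprVn mulrDr.
have -> : (x ^+ 6) ^+ 2 * x^-1 ^+ 14 = x^-1 ^+ 2.
  by rewrite -exprM (_ : 14 = (6 * 2 + 2))%N// exprD mulrA ixn mul1r.
have -> : (x ^+ 6) ^+ 2 * (x ^+ 14 * (5 * x ^+ 6 / sk)) = 5 * (x ^+ 32 * sk^-1).
  by rewrite -exprM (_ : 32 = (6 * 2 + 14 + 6))%N// !exprD; ring.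
have h1 : x ^+ 32 * sk^-1 <= 2 * x^-1 ^+ 2.
  apply: le_trans (ler_wpM2l (ltW (xn 32%N)) hk) _.
  rewrite (_ : 48 = (32 + 16))%N// exprD mulrCA (mulrA (x ^+ 32)) ixn mul1r.
  rewrite ler_pM2l//; apply: ler_wiXn2l => //; exact: ltW.
have h2 : sm^-1 * (396 * x + 1) <= 794 * x^-1 ^+ 2.
  apply: le_trans (_ : 2 * x^-1 ^+ 3 * (397 * x) <= _).
    apply: ler_pM hm _; [by rewrite invr_ge0 ltW|lra|lra].
  rewrite exprSr (_ : _ * _ = 794 * x^-1 ^+ 2 * (x * x^-1)); first by rewrite xx mulr1.
  by ring.
have h3 : 0 <= x^-1 ^+ 2 by rewrite exprn_ge0// ltW.
have -> : 4 / sm * (396 * x + 1) = 4 * (sm^-1 * (396 * x + 1)) by ring.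
lra.
Qed.

Lemma core_error_level_ge0 j w : 0 <= core_error (core_size j) (level j) (level j.+1)
  ((scale_index j)%:R ^+ 14)^-1 w.
Proof. by apply: core_error_ge0; rewrite invr_gt0 exprn_gt0. Qed.

Lemma net_error_level_ge0 j w :
  0 <= net_error (core_size j) (level j.+1) (396 * (scale_index j)%:R) w.
Proof.
apply: (@net_error_ge0 (core_size j) (level j) (level j.+1)).
- exact: core_size_ge.
- exact: core_size_le_level.
- exact: level_homo.
- by rewrite mulr_ge0 ?ler0n.
Qed.

Lemma loop_error_ge0 j w : 0 <= loop_error j w.
Proof. by rewrite addr_ge0 ?core_error_level_ge0 ?net_error_level_ge0. Qed.

Lemma measurable_loop_error j : measurable_fun setT (EFin \o loop_error j).
Proof.
have -> : EFin \o loop_error j = ((EFin \o core_error (core_size j) (level j)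
    (level j.+1) ((scale_index j)%:R ^+ 14)^-1) \+
    (EFin \o net_error (core_size j) (level j.+1) (396 * (scale_index j)%:R)))%E.
  by apply/funext => w.
apply: emeasurable_funD.
  exact: measurable_core_error (core_size_ge j) (core_size_le_level j) (level_homo j).
exact: measurable_net_error (core_size_ge j) (core_size_le_level j) (level_homo j).
Qed.

Lemma integral_loop_error j :
  (\int[P]_w (loop_error j w)%:E <= (3200 / (scale_index j)%:R ^+ 2)%:E)%E.
Proof.
have m0 := core_size_ge j; have mk := core_size_le_level j; have kk' := level_homo j.
have N1 : 1 <= (scale_index j)%:R :> R by rewrite ler1n.
have eps0 : 0 < ((scale_index j)%:R ^+ 14)^-1 :> R by rewrite invr_gt0 exprn_gt0.
have L0 : 0 <= 396 * (scale_index j)%:R :> R by rewrite mulr_ge0 ?ler0n.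
have hc := integral_core_error m0 mk kk' eps0.
have hn := integral_net_error m0 mk kk' L0.
rewrite (_ : (\int[P]_w _)%E = (\int[P]_w (core_error (core_size j) (level j)
    (level j.+1) ((scale_index j)%:R ^+ 14)^-1 w)%:E +
    \int[P]_w (net_error (core_size j) (level j.+1) (396 * (scale_index j)%:R) w)%:E)%E);
    last first.
  rewrite -ge0_integralD//.
  - by move=> w _; rewrite lee_fin core_error_level_ge0.
  - exact: measurable_core_error m0 mk kk'.
  - by move=> w _; rewrite lee_fin net_error_level_ge0.
  - exact: measurable_net_error m0 mk kk'.
apply: le_trans (leeD hc hn) _; rewrite -EFinD lee_fin.
have smge : (scale_index j)%:R ^+ 3 / 2 <= loop_scale R (core_size j).
  by apply: loop_scale_ge; rewrite ?exprn_ge0 ?expn_gt0// -exprM natrX.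
have skge : (scale_index j)%:R ^+ 48 / 2 <= loop_scale R (level j).
  by apply: loop_scale_ge; rewrite ?exprn_ge0 ?expn_gt0// -exprM natrX.
apply: le_trans (rate N1 smge skge); apply: lerD; first by rewrite natrX.
apply: ler_wpM2l.
  by rewrite divr_ge0// (le_trans _ smge)// divr_ge0 ?exprn_ge0.
rewrite lerD2l; have := expR_weight N1.
by rewrite /height_weight /level scale_indexS natrX -[(scale_index j).+1%:R]natr1.
Qed.

(** The expected total error is finite, so the total is almost surely finite, and a series of
    nonnegative terms with finite sum converges. *)
Lemma ae_cvg_loop_error : {ae P, forall w, cvgn (series (loop_error ^~ w))}.
Proof.
pose g w : \bar R := (\sum_(0 <= j <oo) (loop_error j w)%:E)%E.
have e0 j w : (0 <= (loop_error j w)%:E)%E by rewrite lee_fin loop_error_ge0.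
have mg : measurable_fun setT g.
  apply: ge0_emeasurable_sum => //.
  by move=> j _; exact (measurable_loop_error j).
have g0 w : (0 <= g w)%E by exact: nneseries_ge0.
have [c [c0 ec]] : exists c : R, 0 <= c /\ forall j,
    (\int[P]_w (loop_error j w)%:E <= (c / (scale_index j)%:R ^+ 2)%:E)%E.
  by exists 3200%:R; split; [exact: ler0n|move=> j; exact (integral_loop_error j)].
have intg : (\int[P]_w g w <= (2 * c)%:E)%E.
  rewrite integral_nneseries//; last by move=> j; exact (measurable_loop_error j).
  apply: lime_le; first by apply: is_cvg_nneseries => j _ _; exact: integral_ge0.
  apply: nearW => J; apply: le_trans (_ : (\sum_(0 <= j < J) (c / (scale_index j)%:R ^+ 2)%:E <= _)%E).
    by apply: lee_sum => j _; exact: ec.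
  rewrite sumEFin lee_fin.
  (* Telescoping: 1/(j+1)^2 <= 2/((j+1)(j+2)) = 2 (1/(j+1) - 1/(j+2)). *)
  apply: le_trans (_ : (2 * c) * (1 - J.+1%:R^-1) <= _); last first.
    by apply: ler_piMr; rewrite ?mulr_ge0// gerBl invr_ge0 ler0n.
  elim: J => [|J IH]; first by rewrite big_geq// invr1 subrr mulr0.
  rewrite big_nat_recr//=; apply: le_trans (lerD IH (lexx _)) _.
  have -> : (2 * c) * (1 - J.+2%:R^-1) = (2 * c) * (1 - J.+1%:R^-1) +
      (2 * c) / (J.+1%:R * J.+2%:R) :> R.
    rewrite -[J.+2%:R]natr1; have : 0 < J.+1%:R :> R by rewrite ltr0n.
    by move: (J.+1%:R : R) => x x0; field; rewrite !gt_eqF//; lra.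
  rewrite lerD2l.
  have NJ : J.+1%:R <= (scale_index J)%:R :> R by rewrite ler_nat ltnS leq_addl.
  have J1 : 1 <= J.+1%:R :> R by rewrite ler1n.
  rewrite ler_pdivrMr ?exprn_gt0 ?ltr0n// mulrAC ler_pdivlMr ?mulr_gt0 ?ltr0n//.
  rewrite -[J.+2%:R]natr1; move: (J.+1%:R : R) ((scale_index J)%:R : R) NJ J1 => y z yz y1.
  have h : y * (y + 1) <= 2 * z ^+ 2 by nra.
  by have := ler_wpM2l c0 h; lra.
have : P.-integrable setT g.
  apply/integrableP; split => //; apply: le_lt_trans (_ : _ <= \int[P]_w g w)%E _.
    by apply: ge0_le_integral => //; [exact: measurableT_comp|move=> w _; rewrite gee0_abs].
  exact: le_lt_trans intg (ltry _).
move=> /integrable_ae -/(_ measurableT); apply: filterS => w /(_ I) gfin.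
apply: nondecreasing_is_cvgn.
  by apply/nondecreasing_seqP => J; rewrite /series /= big_nat_recr//= lerDl loop_error_ge0.
exists (fine (g w)) => _ [J _ <-].
rewrite -lee_fin fineK// /series /= -sumEFin.
exact: nneseries_lim_ge.
Qed.

End ErrorProcess.

(** * Almost sure convergence *)

Section GraftedSequence.
Variables (R : realType) (S : plane_tree) (t : nat -> plane_tree).
Hypothesis t_nedges : forall k, (nedges S <= k)%N -> nedges (t k) = k.
Hypothesis t_graft : forall k, (nedges S <= k)%N ->
  exists c : corner (t k), t k.+1 = graft c.

Lemma loop_dist_grafted k k' e f : (nedges S <= k)%N -> (k <= k')%N ->
  (e < k)%N -> (f < k)%N -> (loop_dist (t k) e f <= loop_dist (t k') e f)%N.
Proof.
move=> Sk kk' ek fk; rewrite -(subnKC kk'); move: (k' - k)%N => l.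
elim: l => [|l IH]; first by rewrite addn0.
have Sl : (nedges S <= k + l)%N := leq_trans Sk (leq_addr _ _).
apply: leq_trans IH _; rewrite addnS; have [c ->] := t_graft Sl.
by apply: loop_dist_graft_ge; rewrite t_nedges//; exact: ltn_addr.
Qed.

Let index_ratio (j : nat) : R := (scale_index S j.+1)%:R / (scale_index S j)%:R.

Let inv_index_cvg : (fun j => (scale_index S j)%:R^-1 : R) @ \oo --> (0 : R).
Proof.
have := @cvg_harmonic R; rewrite -(cvg_shiftn (nedges S)).
by under eq_fun do rewrite addnC.
Qed.

Let index_ratio_cvg : index_ratio @ \oo --> (1 : R).
Proof.
have -> : index_ratio = (fun j => 1 + (scale_index S j)%:R^-1).
  apply/funext => j; rewrite /index_ratio scale_indexS -natr1 mulrDl mul1r divff//.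
  by rewrite pnatr_eq0.
suff : (fun j => 1 + (scale_index S j)%:R^-1 : R) @ \oo --> (1 + 0 : R) by rewrite addr0.
by apply: cvgD => //; exact: cvg_cst.
Qed.

Let cvg_exp1 (u : nat -> R) n : u @ \oo --> (1 : R) -> (fun j => u j ^+ n) @ \oo --> (1 : R).
Proof.
move=> u1; elim: n => [|n IH]; first by under eq_fun do rewrite expr0; exact: cvg_cst.
under eq_fun do rewrite exprS.
suff : (fun j => u j * u j ^+ n) @ \oo --> (1 * 1 : R) by rewrite mulr1.
exact: cvgM.
Qed.

(** Between two levels, [Num.sqrt k.+1%:R] lies between the square roots y of those levels, whose
    ratio tends to 1. The normalisation uses k + 1 because a tree with k edges is the tree of time k
    + 1. *)
Lemma grafted_scaling_limit (E : nat -> R) :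
  (forall j, 0 <= E j) -> cvgn (series E) ->
  (forall j e f, (e < core_size S j)%N -> (f < core_size S j)%N ->
    (loop_dist (t (level S j.+1)) e f)%:R / loop_scale R (level S j.+1) <=
    (loop_dist (t (level S j)) e f)%:R / loop_scale R (level S j) + E j) ->
  (forall j v, (v < level S j.+1)%N -> exists2 u, (u < core_size S j)%N &
    (loop_dist (t (level S j.+1)) v u)%:R / loop_scale R (level S j.+1) <= E j) ->
  exists M : compact_metric_space R,
  forall r, 0 < r -> \forall k \near \oo,
    exists C : nat -> M -> Prop,
    [/\ forall v, (v < k)%N -> exists z, C v z,
        forall z, exists2 v, (v < k)%N & C v z,
        forall v z, C v z -> (v < k)%N &
        forall v v' z z', C v z -> C v' z' ->
          `|(loop_dist (t k) v v')%:R / Num.sqrt k.+1%:R - mdist z z'| <= r].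
Proof.
move=> E0 Ec Eincr Enet.
have N0 j : 0 < (scale_index S j)%:R :> R by rewrite ltr0n.
have N1 j : 1 <= (scale_index S j)%:R :> R by rewrite ler1n.
have [y [y_sqr yN y_ratio]] : exists y : nat -> R,
    [/\ forall j, (level S j)%:R = y j ^+ 2, forall j, (scale_index S j)%:R <= y j &
    (fun j => y j.+1 / y j) @ \oo --> (1 : R)].
  exists (fun j => (scale_index S j)%:R ^+ 48); split=> [j|j|].
  - by rewrite /level natrX -exprM.
  - by rewrite exprS ler_peMr ?exprn_ege1// ltW.
  - by under eq_fun do rewrite -expr_div_n; exact: cvg_exp1.
have y0 j : 0 < y j := lt_le_trans (N0 j) (yN j).
pose b j := y j.+1 / y j; pose a j := (1 - (scale_index S j)%:R^-1) * (b j)^-1.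
have b0 j : 0 < b j by rewrite divr_gt0.
have level0 j : (0 < level S j)%N.
  by rewrite -(ltr0n R) y_sqr exprn_gt0.
have sqrt_level j : Num.sqrt (level S j)%:R = y j.
  by rewrite y_sqr sqrtr_sqr gtr0_norm.
have q0 k : 0 < Num.sqrt k.+1%:R :> R by rewrite sqrtr_gt0 ltr0n.
apply: (@scaling_limit R (fun k e f => (loop_dist (t k) e f)%:R) (core_size S) (level S)
  (loop_scale R) (fun k => Num.sqrt k.+1%:R) E a b).
- by move=> k e; rewrite loop_distxx.
- by move=> k e f; rewrite ler0n.
- by move=> k e f; rewrite loop_dist_sym.
- move=> j k f e g mk fk; rewrite -natrD ler_nat; apply: loop_dist_triangle.
  by rewrite t_nedges// (leq_trans (core_size_ge S j)).
- move=> j k k' e f mk kk' ek fk; rewrite ler_nat; apply: loop_dist_grafted => //.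
  exact: leq_trans (core_size_ge S j) mk.
- by move=> i j ij; rewrite /core_size leq_exp2r// ltnS leq_add2l.
- exact: core_size_le_level.
- move=> K; exists K => // j /= Kj; apply: (@leq_trans (scale_index S j)).
    by rewrite ltnS (leq_trans Kj) ?leq_addl.
  by rewrite -[X in (X <= _)%N]expn1; exact: leq_pexp2l.
- by move=> j; exact: loop_scale_gt0.
- exact: q0.
- exact: E0.
- exact: Ec.
- exact: Eincr.
- exact: Enet.
- move=> j k /andP[_ kn].
  have qle : Num.sqrt k.+1%:R <= y j.+1.
    by rewrite -sqrt_level; apply: ler_wsqrtr; rewrite ler_nat; exact: kn.
  have u1 : (scale_index S j)%:R^-1 <= 1 :> R by rewrite invf_le1.
  (* With x the index, the factor 1 - 1/x absorbs the -1/2 in [loop_scale]: it lowers y^2 by at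
     least y^2 / x >= 1, as y >= x >= 1. *)
  have sge : (1 - (scale_index S j)%:R^-1) * y j <= loop_scale R (level S j).
    have u0 : 0 < (scale_index S j)%:R^-1 :> R by rewrite invr_gt0.
    rewrite -(@ler_pXn2r _ 2) ?nnegrE; last 3 first.
    - by [].
    - by rewrite mulr_ge0 ?subr_ge0// ltW.
    - exact/ltW/loop_scale_gt0.
    rewrite loop_scale_sqr; last exact: level0.
    rewrite y_sqr exprMn; move: (yN j) (N1 j) (y0 j) (divff (lt0r_neq0 (N0 j))) u1 u0.
    move: (y j) (scale_index S j)%:R (scale_index S j)%:R^-1 => z x u.
    move=> xz x1 z0 xu u1 u0; have uz : 1 <= u * z by rewrite -xu mulrC ler_pM2l.
    have uzz : 1 <= u * z * z by nra.
    have : (1 - u) ^+ 2 * z ^+ 2 <= (1 - u) * z ^+ 2.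
      by apply: ler_wpM2r; [exact: sqr_ge0|nra].
    have -> : (1 - u) * z ^+ 2 = z ^+ 2 - u * z * z by ring.
    lra.
  rewrite /a /b invf_div mulrA; apply: ler_pM.
  + by rewrite mulr_ge0 ?subr_ge0// ltW.
  + by rewrite invr_ge0 ltW.
  + exact: sge.
  + by rewrite lef_pV2 ?posrE.
- move=> j k /andP[nk _].
  have qge : y j <= Num.sqrt k.+1%:R.
    by rewrite -sqrt_level; apply: ler_wsqrtr; rewrite ler_nat; exact: leqW nk.
  have sle : loop_scale R (level S j.+1) <= y j.+1.
    by rewrite -sqrt_level; apply: ler_wsqrtr; rewrite gerBl invr_ge0.
  rewrite /b; apply: ler_pM.
  + exact/ltW/loop_scale_gt0.
  + by rewrite invr_ge0 ltW.
  + exact: sle.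
  + by rewrite lef_pV2 ?posrE.
- have b1 : (fun j => (b j)^-1) @ \oo --> (1^-1 : R).
    by apply: cvgV; [exact: oner_neq0|exact: y_ratio].
  have c1 : (fun j => 1 - (scale_index S j)%:R^-1 : R) @ \oo --> (1 - 0 : R).
    by apply: cvgB => //; exact: cvg_cst.
  suff : a @ \oo --> ((1 - 0) * 1^-1 : R) by rewrite subr0 invr1 mulr1.
  exact: cvgM.
- exact: y_ratio.
Qed.

End GraftedSequence.

Section RandomLimit.
Variables (R : realType) (d : measure_display) (Omega : measurableType d).
Variables (P : probability Omega R) (S : plane_tree) (T : nat -> Omega -> plane_tree).
Hypothesis hT : preferential_attachment P S T.

Lemma measurable_tree n (B : plane_tree -> Prop) : (tree_order S <= n)%N ->
  measurable [set w | B (T n w)].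
Proof.
move=> Sn; apply: (measurable_history hT (n := n)) => w w' E.
by rewrite /= (history_tree Sn E).
Qed.

Lemma grafted_loop_limit w : grafted S T w ->
  cvgn (series (loop_error R S T ^~ w)) ->
  exists M : compact_metric_space R,
  forall r, 0 < r -> \forall k \near \oo,
    exists C : nat -> M -> Prop,
    [/\ forall v, (v < k)%N -> exists z, C v z,
        forall z, exists2 v, (v < k)%N & C v z,
        forall v z, C v z -> (v < k)%N &
        forall v v' z z', C v z -> C v' z' ->
          `|(loop_dist (T k.+1 w) v v')%:R / Num.sqrt k.+1%:R - mdist z z'| <= r].
Proof.
move=> gw cw; have Tn k : (nedges S <= k)%N -> nedges (T k.+1 w) = k.
  exact: grafted_nedges gw.
apply: (@grafted_scaling_limit R S (fun k => T k.+1 w) _ _ (loop_error R S T ^~ w)) => //.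
- by move=> k Sk; case: gw => _; apply; rewrite tree_orderE ltnS.
- by move=> j; exact: loop_error_ge0.
- move=> j e f em fm.
  have eps0 : 0 < ((scale_index S j)%:R ^+ 14)^-1 :> R by rewrite invr_gt0 exprn_gt0 ?ltr0n.
  apply: le_trans (core_error_incr T (level S j) (level S j.+1) eps0 w em fm) _.
  by rewrite lerD2l lerDl; exact: net_error_level_ge0.
- move=> j v vn.
  have Sn : (nedges S <= level S j.+1)%N.
    exact: leq_trans (core_size_ge S j.+1) (core_size_le_level S j.+1).
  have [u um h] := net_error_net (396 * (scale_index S j)%:R : R) (core_size_ge S j)
    (core_size_le_level S j) (level_homo S j) (Tn _ Sn) vn.
  exists u => //; apply: le_trans h _.
  by rewrite lerDr; exact: core_error_level_ge0.
Qed.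

Lemma grafted_gh_limit w (c : R) : 0 < c -> grafted S T w ->
  cvgn (series (loop_error R S T ^~ w)) ->
  exists L : compact_metric_space R,
    (fun n => gh_dist (rescale (n%:R `^ (- 2^-1)) (Loop R (T n w))) (rescale c L))
      @ \oo --> (0 : R).
Proof.
move=> c0 gw cw; have [M hM] := grafted_loop_limit gw cw.
exists (rescale c^-1 M); rewrite -cvg_shiftS.
have ci : 0 < c^-1 by rewrite invr_gt0.
apply/cvgrPdist_lt => e e0; have e4 : 0 < e / 4 by rewrite divr_gt0.
have Sk : \forall k \near \oo, (nedges S <= k)%N by exists (nedges S).
near=> k; rewrite sub0r normrN ger0_norm ?gh_dist_ge0//.
have Tk : nedges (T k.+1 w) = k by apply: grafted_nedges gw _; near: k.
have [C [CX CY Clt Cr]] : exists C : nat -> M -> Prop,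
    [/\ forall v, (v < k)%N -> exists z, C v z,
        forall z, exists2 v, (v < k)%N & C v z,
        forall v z, C v z -> (v < k)%N &
        forall v v' z z', C v z -> C v' z' ->
          `|(loop_dist (T k.+1 w) v v')%:R / Num.sqrt k.+1%:R - mdist z z'| <= e / 4].
  by near: k; exact: hM.
apply: (@le_lt_trans _ _ (2 * (e / 4))); last by lra.
pose X := rescale (k.+1%:R `^ (- 2^-1)) (Loop R (T k.+1 w)).
pose Y := rescale c (rescale c^-1 M).
pose C' (x : X) (z : Y) := C (x : 'I_(nedges (T k.+1 w))) (z : M).
apply: (@correspondence_gh_dist R X Y C') => //; split.
- move=> x; apply: CX; rewrite -[X in (_ < X)%N]Tk; exact: ltn_ord.
- move=> z; have [v vk vz] := CY z; have vT : (v < nedges (T k.+1 w))%N by rewrite Tk.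
  by exists (Ordinal vT : X).
- move=> x x' z z' xz xz'; have := Cr _ _ _ _ xz xz'.
  have -> : mdist x x' = k.+1%:R `^ (- 2^-1) * (loop_dist (T k.+1 w)
      (x : 'I_(nedges (T k.+1 w))) (x' : 'I_(nedges (T k.+1 w))))%:R :> R.
    rewrite loop_distE; transitivity (scaled_dist (c := k.+1%:R `^ (- 2^-1))
       (M := Loop R (T k.+1 w)) x x') => //.
    by rewrite /scaled_dist /scale_factor powR_gt0 ?ltr0n.
  have -> : mdist z z' = mdist (z : M) (z' : M) :> R.
    transitivity (scale_factor c * (scale_factor c^-1 * mdist (z : M) (z' : M))) => //.
    by rewrite /scale_factor c0 ci mulrA divff ?mul1r// gt_eqF.
  by rewrite powRN powR12_sqrt// mulrC.
Unshelve. all: by end_near. Qed.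

(** * Measurability of a limit chosen path by path *)

Section Measurability.
Variables (c : R) (N : set Omega) (X0 : compact_metric_space R).
Variable L : Omega -> compact_metric_space R.
Hypothesis c1 : 1 <= c.
Hypothesis mN : measurable N.
Hypothesis L0 : forall w, N w -> L w = X0.
Hypothesis L_cvg : forall w, ~ N w ->
  (fun n => gh_dist (rescale (n%:R `^ (- 2^-1)) (Loop R (T n w))) (rescale c (L w)))
      @ \oo --> (0 : R).

Let Y n t : compact_metric_space R :=
  rescale c^-1 (rescale (n%:R `^ (- 2^-1)) (Loop R t)).

(** Scaling by 1/c <= 1 does not increase the distortion of a correspondence, so approximations of
    the scaled limit become approximations of the limit itself. *)
Let rescale_gh_dist (X Z : compact_metric_space R) e :
  gh_dist X (rescale c Z) < e -> gh_dist (rescale c^-1 X) Z <= 4 * e.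
Proof.
move=> XZ; have e0 := le_lt_trans (gh_dist_ge0 _ _) XZ.
have c0 : 0 < c := lt_le_trans ltr01 c1.
have ci : 0 < c^-1 by rewrite invr_gt0.
have [C [CX CZ Cr]] := gh_dist_correspondence XZ.
rewrite (_ : 4 * e = 2 * (2 * e)); last by ring.
apply: (@correspondence_gh_dist R (rescale c^-1 X) Z C); first by rewrite mulr_gt0.
split; [exact: CX|exact: CZ|move=> x x' z z' xz xz'].
have := Cr _ _ _ _ xz xz'.
have -> : mdist x x' = c^-1 * mdist (x : X) (x' : X) :> R.
  transitivity (scale_factor c^-1 * mdist (x : X) (x' : X)) => //.
  by rewrite /scale_factor ci.
have -> : mdist (z : rescale c Z) z' = c * mdist z z' :> R.
  transitivity (scale_factor c * mdist z z') => //.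
  by rewrite /scale_factor c0.
set a := mdist _ _; set b := mdist _ _ => h.
have -> : c^-1 * a - b = c^-1 * (a - c * b).
  by rewrite mulrBr mulrA mulVf ?mul1r// gt_eqF.
rewrite normrM gtr0_norm//; apply: le_trans h; apply: ler_piMl => //.
by rewrite invf_le1.
Qed.

(** For an open [U] and [w] outside [N], [L w] is in [U] iff, for some p, the balls of radius 1/(p +
    1) around the rescaled looptrees are contained in [U] for all large n. For fixed p and n this is
    an event about [T n], and the remaining quantifiers are countable. *)
Lemma random_limit : random_compact_metric_space L.
Proof.
pose U_ (U : compact_metric_space R -> Prop) p X :=
  forall Z, gh_dist X Z < p.+1%:R^-1 -> U Z.
have opn U : gh_open U -> measurable [set w | U (L w)].
  move=> oU.
  have -> : [set w | U (L w)] = (N `&` [set _ | U X0]) `|` (~` N `&`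
      \bigcup_p \bigcup_K \bigcap_(n in [set n | (maxn (tree_order S) K <= n)%N])
        [set w | U_ U p (Y n (T n w))]).
    apply/seteqP; split=> w /=; last first.
      move=> [[Nw]|[nNw [p _ [K _ hK]]]]; first by rewrite L0.
      have p0 : 0 < p.+1%:R^-1 / 8 :> R by rewrite divr_gt0 ?invr_gt0.
      have /cvgrPdist_lt /(_ _ p0) near_gh := L_cvg nNw.
      have near_K : \forall n \near \oo, (maxn (tree_order S) K <= n)%N.
        by exists (maxn (tree_order S) K).
      have [n [/= gn Kn]] := filter_ex (filterI near_gh near_K).
      apply: (hK n Kn); rewrite sub0r normrN ger0_norm ?gh_dist_ge0// in gn.
      apply: le_lt_trans (rescale_gh_dist gn) _.
      by move: p0; move: (p.+1%:R^-1) => x; lra.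
    have [Nw|nNw] := pselect (N w); first by rewrite L0//; left.
    move=> /oU[e e0 he]; right; split => //.
    (* Rescaling, symmetry and the triangle inequality each lose a factor 4: 4 e/96 < e/23, then 4
       e/23 < e/5, then 4 (e/5 + e/96) < e. *)
    have e96 : 0 < e / 96 by rewrite divr_gt0.
    have [p hp] : exists p : nat, p.+1%:R^-1 < e / 96.
      have /cvgrPdist_lt /(_ _ e96) := @cvg_harmonic R.
      move=> [p _ /(_ p (leqnn p))] /=; rewrite sub0r normrN ger0_norm//.
      by exists p.
    exists p => //.
    have /cvgrPdist_lt /(_ _ e96) [K _ hK] := L_cvg nNw.
    exists K => // n /=; rewrite geq_max => /andP[_ Kn] Z YZ; apply: he.
    have := hK n Kn; rewrite /= sub0r normrN ger0_norm ?gh_dist_ge0// => gn.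
    have YL : gh_dist (Y n (T n w)) (L w) < e / 23.
      by apply: le_lt_trans (rescale_gh_dist gn) _; lra.
    have LY : gh_dist (L w) (Y n (T n w)) < e / 5.
      by apply: le_lt_trans (gh_dist_sym_lt YL) _; lra.
    apply: le_lt_trans (gh_dist_triangle_lt LY (lt_trans YZ hp)) _.
    lra.
  apply: measurableU.
    have [UX|nUX] := pselect (U X0).
      rewrite (_ : [set _ | _] = setT) ?setIT//; by apply/seteqP; split.
    rewrite (_ : [set _ | _] = set0) ?setI0//; by apply/seteqP; split.
  apply: measurableI; first exact: measurableC.
  apply: bigcupT_measurable => p; apply: bigcupT_measurable => K.
  apply: bigcap_measurable.
    by exists (maxn (tree_order S) K) => /=.
  move=> n /=; rewrite geq_max => /andP[Sn _].
  exact: (@measurable_tree n (fun t => U_ U p (Y n t))).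
move=> B; elim=> [U|B' _ mB|B' _ mB].
- exact: opn.
- have -> : [set w | ~ B' (L w)] = ~` [set w | B' (L w)] by [].
  exact: measurableC.
- have -> : [set w | exists n, B' n (L w)] = \bigcup_n [set w | B' n (L w)].
    by apply/seteqP; split=> w /= [n]; [exists n|move=> _; exists n].
  exact: bigcupT_measurable.
Qed.

End Measurability.

End RandomLimit.

Theorem corollary3 (R : realType) (d : measure_display)
    (Omega : measurableType d) (P : probability Omega R)
    (S : plane_tree) (hS : (2 <= tree_order S)%N)
    (T : nat -> Omega -> plane_tree) (hT : preferential_attachment P S T) :
  exists L : Omega -> compact_metric_space R,
    random_compact_metric_space L /\
    {ae P, forall w : Omega,
      (fun n : nat => gh_dist (rescale (n%:R `^ (- 2^-1)) (Loop R (T n w)))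
                              (rescale (2 * Num.sqrt 2) (L w)))
        @ \oo --> (0 : R)}.
Proof.
have s2 : 1 <= Num.sqrt 2 :> R by rewrite -[leLHS]sqrtr1 ler_wsqrtr// ler1n.
have c0 : 0 < 2 * Num.sqrt 2 :> R by lra.
have [N [mN PN sub]] := filterI (ae_grafted hT) (ae_cvg_loop_error hT).
have lim w : ~ N w -> exists L : compact_metric_space R,
    (fun n => gh_dist (rescale (n%:R `^ (- 2^-1)) (Loop R (T n w)))
      (rescale (2 * Num.sqrt 2) L)) @ \oo --> (0 : R).
  move=> nN; have [gw cw] : grafted S T w /\ cvgn (series (loop_error R S T ^~ w)).
    by apply: contrapT => h; exact: nN (sub w h).
  exact: grafted_gh_limit c0 gw cw.
(* The limit is picked by choice outside the measurable null set [N] and is constant on it;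
   [random_limit] needs nothing else about the selection than the convergence. *)
pose L w := match pselect (N w) with
  | left _ => Loop R S
  | right h => projT1 (cid (lim w h))
  end.
have L_cvg w : ~ N w ->
    (fun n => gh_dist (rescale (n%:R `^ (- 2^-1)) (Loop R (T n w)))
      (rescale (2 * Num.sqrt 2) (L w))) @ \oo --> (0 : R).
  by move=> nN; rewrite /L; case: pselect => // h; exact: projT2 (cid (lim w h)).
exists L; split.
  apply: (random_limit hT (c := 2 * Num.sqrt 2) (N := N) (X0 := Loop R S)) => //.
    by lra.
  by move=> w Nw; rewrite /L; case: pselect.
exists N; split => // w /= h; apply: contrapT => /L_cvg; exact: h.
Qed.
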